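(* Let $H\in(\tfrac12,1)$, $\sigma>0$. Then $\mathcal{Y}_n^H\to\mathcal{Y}_H$ in distribution as $n\to\infty$.
   Context: $c_H=\sqrt{\frac{2H\,\Gamma(\frac32-H)}{\Gamma(H+\frac12)\Gamma(2-2H)}}$, $C_H=c_H(H-\frac12)$, $g_H=\frac{\sigma c_H}{H+\frac12}$, $h=\frac H2+\frac14$, $\rho_h(k)=\frac12((k+1)^{2h}+(k-1)^{2h}-2k^{2h})$, and for $1\le i<n$, $j_n^H(i)=\sigma C_H\int_{i-1}^i x^{\frac12-H}\Big(\int_0^1(v+n-1)^{H-\frac12}(v+n-1-x)^{H-\frac32}dv\Big)dx$. Let $(\xi_i)_{i\ge1}$ be i.i.d. with $P(\xi_i=\pm1)=\frac12$, $\mathcal{Y}_n^H=\sum_{i=1}^{n-1}j_n^H(i)\xi_i$, and $\mathcal{Y}_H=2g_H\sum_{k=1}^\infty\rho_h(k)\xi_k$ (almost surely convergent). *)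

(* Defs.v *)
From HB Require Import structures.
From mathcomp Require Import all_boot all_order all_algebra.
From mathcomp Require Import all_classical all_reals all_analysis.
Set Implicit Arguments. Unset Strict Implicit. Unset Printing Implicit Defensive.
Import Order.TTheory GRing.Theory Num.Theory.
Import numFieldNormedType.Exports.
Local Open Scope classical_set_scope.
Local Open Scope ring_scope.

Section Defs.
Variable R : realType.
Local Notation leb := (@lebesgue_measure R).

Definition Gamma (s : R) : R :=
  Rintegral leb `]0, +oo[%classic (fun t => powR t (s - 1) * expR (- t)).

Definition c_H (H : R) : R :=
  Num.sqrt ((2 * H * Gamma (3 / 2 - H)) /
            (Gamma (H + 1 / 2) * Gamma (2 - 2 * H))).

Definition C_H (H : R) : R := c_H H * (H - 1 / 2).

Definition g_H (sigma H : R) : R := sigma * c_H H / (H + 1 / 2).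

Definition h_of (H : R) : R := H / 2 + 1 / 4.

Definition rho (h : R) (k : nat) : R :=
  (powR (k.+1%:R) (2 * h) + powR (k.-1%:R) (2 * h)
     - 2 * powR (k%:R) (2 * h)) / 2.

Definition j_nH (sigma H : R) (n i : nat) : R :=
  sigma * C_H H *
  Rintegral leb `[(i%:R - 1), i%:R]%classic (fun x =>
    powR x (1 / 2 - H) *
    Rintegral leb `[0, 1]%classic (fun v =>
      powR (v + n%:R - 1) (H - 1 / 2) *
      powR (v + n%:R - 1 - x) (H - 3 / 2))).

Variables (d : measure_display) (T : measurableType d) (P : probability T R).

Definition mutually_independent (X : nat -> T -> R) (I : set nat) : Prop :=
  forall (J : seq nat), uniq J -> (forall k, k \in J -> I k) ->
  forall B : nat -> set R, (forall k, measurable (B k)) ->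
  P (\bigcap_(k in [set` J]) (X k @^-1` B k)) =
  (\prod_(k <- J) P (X k @^-1` B k))%E.

Definition rademacher (X : T -> R) : Prop :=
  P (X @^-1` [set 1]) = (1 / 2)%:E /\ P (X @^-1` [set -1]) = (1 / 2)%:E.

Definition Yn (sigma H : R) (xi : nat -> T -> R) (n : nat) : T -> R :=
  fun w => \sum_(1 <= i < n) j_nH sigma H n i * xi i w.

(* partial sums 2 g_H sum_{k=1}^N rho_h(k) xi_k, and Y_H their (a.s.) limit *)
Definition Ypartial (sigma H : R) (xi : nat -> T -> R) (N : nat) : T -> R :=
  fun w => 2 * g_H sigma H * \sum_(1 <= k < N.+1) rho (h_of H) k * xi k w.

Definition YH (sigma H : R) (xi : nat -> T -> R) : T -> R :=
  fun w => limn (fun N => Ypartial sigma H xi N w).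

Definition cvg_in_distribution (X : nat -> T -> R) (Y : T -> R) : Prop :=
  forall f : R -> R, continuous f -> (exists M : R, forall x, `|f x| <= M) ->
  ((fun n => 'E_P[f \o X n]) @ \oo --> 'E_P[f \o Y])%E.

End Defs.

(* Main.v *)
Require Import Defs.
From HB Require Import structures.
From mathcomp Require Import all_boot all_order all_algebra.
From mathcomp Require Import all_classical all_reals all_analysis.
From mathcomp Require Import measurable_realfun ring lra.
Import Order.TTheory GRing.Theory Num.Theory.
Import numFieldNormedType.Exports.
Local Open Scope classical_set_scope.
Local Open Scope ring_scope.

(* Write a = H - 1/2. Since the signs are exchangeable, Y_n has the law of the
   sum of j_n(n-k) xi_k over k < n. For fixed k, squeezing x^(-a) (v+n-1)^a
   between powers of ratios tending to 1 gives j_n(n-k) -> 2 g_H rho_h(k),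
   and j_n(n-k)^2 <= C (k^(2a-2) + n^(4a-2) (n-k)^(-2a)) makes the tails of the
   sums of squares uniformly small. Kolmogorov's maximal inequality, proved by
   stopping the walk and flipping a sign, then yields both the almost sure
   convergence of the series and the convergence in probability of the
   reversed sums to it. *)

(** In the original order the weight of Y_n sits on the last signs, which change with n: for fixed
    i, j_n(i) is of order n^(2a-1) and vanishes. Reversal moves this weight to the first signs,
    where the coefficients have limits; it preserves only the law, which is all that the
    expectations of f see. Replacing x^(-a) (v+n-1)^a by 1 leaves the integral of (v+n-1-x)^(a-1)
    over a unit square, a second difference of t^(a+1)/(a(a+1)). Since a+1 = 2h, this is rho_h up to
    a constant. H < 1 enters as 2a < 1: then k^(2a-2) is summable, and the sum of i^(-2a) over i < n
    is O(n^(1-2a)), so that the second term of the bound contributes O(n^(2a-1)). On the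
    probabilistic side, an event at a finite stage depends on n fair bits, so its probability is a
    count over [{ffun 'I_n -> bool}]. Orthogonality of increments and exchangeability become
    reindexings of finite sums. *)

(** * Stopped sign walks and the maximal inequality as a count *)

Section SignWalk.
Variable R : realType.
Implicit Types (b : nat -> R) (t : nat -> bool) (lam : R).

Definition sgn_of (x : bool) : R := if x then 1 else -1.

Definition walk b t (k : nat) : R := \sum_(i < k) b i * sgn_of (t i).

(** Freezing turns an event about the running maximum into one about the terminal value. Whether
    step [k'] is taken depends only on the bits before [k']. *)
Fixpoint stopped_walk lam b t (k : nat) : R :=
  if k is k'.+1 then
    let x := stopped_walk lam b t k' in
    if lam <= `|x| then x else x + b k' * sgn_of (t k')
  else 0.

Lemma eq_stopped_walk lam b t t' k : (forall i, (i < k)%N -> t i = t' i) ->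
  stopped_walk lam b t k = stopped_walk lam b t' k.
Proof.
elim: k => //= k IH tt'; rewrite tt'// IH// => i ik.
by apply: tt'; exact: ltnW.
Qed.

Lemma eq_walk b t t' k : (forall i, (i < k)%N -> t i = t' i) ->
  walk b t k = walk b t' k.
Proof. by move=> tt'; apply: eq_bigr => i _; rewrite tt'. Qed.

Lemma stopped_walk_max lam b t k j : (j <= k)%N -> lam <= `|walk b t j| ->
  lam <= `|stopped_walk lam b t k|.
Proof.
move=> jk lj.
(* Invariant: either the walk has been frozen at a value of modulus at least [lam], or no freezing
   has occurred and all values so far are below [lam]. *)
suff [//|[_ /(_ _ jk)]] : lam <= `|stopped_walk lam b t k| \/
   stopped_walk lam b t k = walk b t k /\ forall i, (i <= k)%N -> `|walk b t i| < lam.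
  by rewrite ltNge lj.
elim: k {j jk lj} => [|k [IH|[E IH]]] /=.
- rewrite normr0; have [|l0] := leP lam 0; first by left.
  right; rewrite /walk big_ord0; split => // i; rewrite leqn0 => /eqP ->.
  by rewrite big_ord0 normr0.
- by left; rewrite IH.
- have := IH k (leqnn k); rewrite ltNge => /negbTE ltk; rewrite E ltk.
  have -> : walk b t k + b k * sgn_of (t k) = walk b t k.+1.
    by rewrite /walk big_ord_recr.
  have [|lk] := leP lam `|walk b t k.+1|; first by left.
  right; split => // i; rewrite leq_eqVlt => /predU1P[->//|]; exact: IH.
Qed.

Variable n : nat.
Implicit Types e : {ffun 'I_n -> bool}.

(** Walks read bits indexed by [nat]; the default [false] lies beyond the horizon [n] and is never
    read by a walk of length at most [n]. *)
Definition bits e (i : nat) : bool := odflt false (omap e (insub i)).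

Lemma bitsE e (i : 'I_n) : bits e i = e i.
Proof. by rewrite /bits valK. Qed.

Definition flip (k : nat) e : {ffun 'I_n -> bool} :=
  [ffun i : 'I_n => (i == k :> nat) (+) e i].

Lemma flipK k : involutive (flip k).
Proof. by move=> e; apply/ffunP => i; rewrite !ffunE addbA addbb. Qed.

Lemma bits_flip k e i : (i < n)%N -> bits (flip k e) i = (i == k) (+) bits e i.
Proof. by move=> ni; rewrite -[i]/(val (Ordinal ni)) !bitsE ffunE. Qed.

(** Flipping bit [k] is an involution that fixes [g] and negates the sign, so the sum equals its
    opposite. This replaces conditioning on the past. *)
Lemma sum_flip0 k (g : {ffun 'I_n -> bool} -> R) : (k < n)%N ->
  (forall e, g (flip k e) = g e) -> \sum_e g e * sgn_of (bits e k) = 0.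
Proof.
move=> kn gk.
have : \sum_e g e * sgn_of (bits e k) = - \sum_e g e * sgn_of (bits e k).
  rewrite {1}(reindex_inj (inv_inj (flipK k)))/= -sumrN.
  apply: eq_bigr => e _; rewrite gk bits_flip// eqxx -mulrN.
  by case: (bits e k); rewrite /sgn_of/= ?opprK.
by move=> /eqP; rewrite -subr_eq0 opprK -mulr2n mulrn_eq0/= => /eqP.
Qed.

(** Orthogonality of increments: in the expanded square the cross term averages to 0, and a frozen
    step adds nothing, whence an inequality. *)
Lemma sum_stopped_walk_sqr lam b k : (k <= n)%N ->
  \sum_e stopped_walk lam b (bits e) k ^+ 2 <= 2 ^+ n * \sum_(i < k) b i ^+ 2.
Proof.
elim: k => [_|k IH kn].
  by rewrite big_ord0 mulr0 big1// => e _; rewrite expr0n.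
rewrite big_ord_recr/= mulrDr.
(* The factor of the fresh sign in the cross term, set to 0 once frozen; it ignores bit [k], so
   [sum_flip0] applies. *)
pose Y e := if lam <= `|stopped_walk lam b (bits e) k| then 0
            else stopped_walk lam b (bits e) k.
have Y0 : \sum_e (2 * b k * Y e) * sgn_of (bits e k) = 0.
  apply: sum_flip0 => // e; congr (_ * _).
  suff E : stopped_walk lam b (bits (flip k e)) k = stopped_walk lam b (bits e) k.
    by rewrite /Y E.
  by apply: eq_stopped_walk => i ik; rewrite bits_flip ?(ltn_trans ik)// ltn_eqF.
apply: (@le_trans _ _ (\sum_e (stopped_walk lam b (bits e) k ^+ 2 + b k ^+ 2 +
    (2 * b k * Y e) * sgn_of (bits e k)))).
  apply: ler_sum => e _; rewrite /Y; case: ifPn => _.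
    by rewrite mulr0 mul0r addr0 lerDl sqr_ge0.
  by rewrite /sgn_of; case: (bits e k); lra.
rewrite !big_split/= Y0 addr0 lerD ?IH ?(ltnW kn)//.
by rewrite sumr_const card_ffun card_bool card_ord -[leLHS]mulr_natl natrX.
Qed.

Lemma card_max_walk lam b : 0 < lam ->
  #|[pred e | lam <= `|stopped_walk lam b (bits e) n|]|%:R / 2 ^+ n
  <= (\sum_(i < n) b i ^+ 2) / lam ^+ 2.
Proof.
move=> l0; rewrite ler_pdivrMr ?exprn_gt0// mulrAC ler_pdivlMr ?exprn_gt0//.
rewrite (mulrC _ (2 ^+ n)); apply: le_trans (sum_stopped_walk_sqr lam b n (leqnn _)).
rewrite mulr_natl -sumr_const; rewrite big_mkcond/=.
apply: ler_sum => e _; rewrite inE; case: ifPn => [le|_]; last exact: sqr_ge0.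
rewrite -(real_normK (num_real (stopped_walk _ _ _ _))).
by rewrite ler_sqr ?nnegrE// ltW.
Qed.

End SignWalk.

(** * Fair bits and Kolmogorov's maximal inequality *)

Lemma measurable_set_le {R : realType} {d : measure_display}
    {T : measurableType d} (f g : T -> R) :
  measurable_fun setT f -> measurable_fun setT g ->
  measurable [set w | f w <= g w].
Proof.
move=> mf mg; have := measurable_fun_ler mf mg measurableT (Y := [set true]) I.
by rewrite setTI.
Qed.

Section FairBits.
Context {R : realType} {d : measure_display} {T : measurableType d}.
Variables (P : probability T R) (beta : nat -> T -> bool).
Hypothesis mbeta : forall k, measurable [set w | beta k w].
(** Independence and fairness in one condition: the first [n] bits are uniformly distributed. *)
Hypothesis fair : forall n (e : {ffun 'I_n -> bool}),
  P [set w | forall i : 'I_n, beta i w = e i] = (2 ^- n)%:E.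

Definition obs n w : {ffun 'I_n -> bool} := [ffun i : 'I_n => beta i w].

Lemma bits_obs n w i : (i < n)%N -> bits n (obs n w) i = beta i w.
Proof. by move=> ni; rewrite -[i]/(val (Ordinal ni)) bitsE ffunE. Qed.

Lemma obs_eqE n e :
  [set w | obs n w = e] = [set w | forall i : 'I_n, beta i w = e i].
Proof.
by apply/seteqP; split => w /= => [<- i|ew]; [rewrite ffunE|
  apply/ffunP => i; rewrite ffunE].
Qed.

Lemma measurable_obs_eq n e : measurable [set w | obs n w = e].
Proof.
rewrite obs_eqE.
have -> : [set w | forall i : 'I_n, beta i w = e i] =
    \bigcap_(i in [set: 'I_n]) [set w | beta i w = e i].
  by apply/seteqP; split => w /= => [ew i _|ew i]; exact: ew.
apply: fin_bigcap_measurable => // i _.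
case: (e i); first exact: mbeta.
rewrite [X in measurable X](_ : _ = ~` [set w | beta i w]); first exact: measurableC.
apply/seteqP; split => w; first by move=> /= bw; apply/negP; rewrite bw.
by move=> /negP/negbTE.
Qed.

(** A function of finitely many bits is a finite combination of indicators, which yields both its
    measurability and its integral. *)
Lemma obs_indicE n (g : {ffun 'I_n -> bool} -> R) w :
  g (obs n w) = \sum_e g e * \1_[set w | obs n w = e] w.
Proof.
rewrite (bigD1 (obs n w))//= indicE mem_set//= mulr1 big1 ?addr0// => e ne.
by rewrite indicE memNset ?mulr0//= => /esym/eqP; rewrite (negbTE ne).
Qed.

Lemma measurable_obs n (g : {ffun 'I_n -> bool} -> R) :
  measurable_fun setT (fun w => g (obs n w)).
Proof.
under eq_fun do rewrite obs_indicE.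
apply: measurable_sum => e; apply: measurable_funM => //.
exact/measurable_indic/measurable_obs_eq.
Qed.

Lemma measurable_obs_set n (Q : pred {ffun 'I_n -> bool}) :
  measurable [set w | Q (obs n w)].
Proof.
have := measurable_obs n (fun e => (Q e)%:R) measurableT [set 1] (measurable_set1 _).
rewrite setTI; congr (measurable _); apply/seteqP; split => w /=.
  by case: (Q _) => //= /esym/eqP; rewrite oner_eq0.
by move=> ->.
Qed.

Lemma integral_obs n (g : {ffun 'I_n -> bool} -> R) :
  (\int[P]_w (g (obs n w))%:E = ((\sum_e g e) / 2 ^+ n)%:E)%E.
Proof.
under eq_integral do rewrite obs_indicE -sumEFin.
rewrite integral_sum//; last first.
  move=> e; under eq_fun do rewrite EFinM.
  by apply: integrableZl => //; apply: integrable_indic; exact: measurable_obs_eq.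
rewrite mulr_suml -sumEFin; apply: eq_bigr => e _.
under eq_integral do rewrite EFinM.
rewrite integralZl//; last exact/integrable_indic/measurable_obs_eq.
rewrite integral_indic ?setIT//; last exact: measurable_obs_eq.
by rewrite EFinM; congr (_ * _)%E; rewrite -(fair n e) -obs_eqE.
Qed.

Lemma prob_obs n (Q : pred {ffun 'I_n -> bool}) :
  P [set w | Q (obs n w)] = (#|Q|%:R / 2 ^+ n)%:E.
Proof.
rewrite -[X in P X]setIT -integral_indic//; last exact: measurable_obs_set.
transitivity (\int[P]_w ((Q (obs n w))%:R : R)%:E)%E.
  apply: eq_integral => w _; rewrite indicE; congr (_%:R%:E).
  by case: (boolP (Q (obs n w))) => Qw; [rewrite mem_set|rewrite memNset//=; exact/negP].
rewrite (integral_obs n (fun e => (Q e)%:R)).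
by rewrite -natr_sum -sum1_card [in RHS]big_mkcond.
Qed.

Lemma measurable_walk (b : nat -> R) k :
  measurable_fun setT (fun w => walk R b (beta ^~ w) k).
Proof.
have E w : walk R b (beta ^~ w) k = walk R b (bits k (obs k w)) k.
  by apply: eq_walk => i ik; rewrite bits_obs.
under eq_fun do rewrite E.
exact: (measurable_obs k (fun e => walk R b (bits k e) k)).
Qed.

Lemma measurable_max_walk (b : nat -> R) lam n :
  measurable [set w | exists2 j, (j <= n)%N & lam <= `|walk R b (beta ^~ w) j|].
Proof.
rewrite [X in measurable X](_ : _ = \bigcup_(j in [set j | (j <= n)%N])
   [set w | lam <= `|walk R b (beta ^~ w) j|]).
  apply: bigcup_measurable => j _.
  apply: measurable_set_le => //.
  by apply: measurableT_comp => //; exact: measurable_walk.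
by apply/seteqP; split => w /= [j ? ?]; exists j.
Qed.

Lemma kolmogorov_maximal_ineq_fin (b : nat -> R) lam n : 0 < lam ->
  (P [set w | exists2 j, (j <= n)%N & (lam <= `|walk R b (beta ^~ w) j|)%R] <=
   ((\sum_(i < n) b i ^+ 2) / lam ^+ 2)%:E)%E.
Proof.
move=> l0.
pose Q := [pred e : {ffun 'I_n -> bool} | lam <= `|stopped_walk R lam b (bits n e) n|].
apply: (@le_trans _ _ (P [set w | Q (obs n w)])); last first.
  by rewrite prob_obs lee_fin card_max_walk.
apply: le_measure; rewrite ?inE.
- exact: measurable_max_walk.
- exact: measurable_obs_set.
- move=> w /= [j jn /(stopped_walk_max _ _ _ _ _ _ jn)].
  rewrite -(eq_stopped_walk _ _ _ (bits n (obs n w)))// => i ij.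
  by rewrite bits_obs.
Qed.

(** Continuity from below along the increasing events that the level is reached by time [n]; the
    bound [V] is uniform in [n]. *)
Lemma kolmogorov_maximal_ineq (b : nat -> R) lam V : 0 < lam ->
  (forall n, \sum_(i < n) b i ^+ 2 <= V) ->
  (P [set w | exists j, (lam <= `|walk R b (beta ^~ w) j|)%R] <= (V / lam ^+ 2)%:E)%E.
Proof.
move=> l0 bV.
pose F n := [set w | exists2 j, (j <= n)%N & lam <= `|walk R b (beta ^~ w) j|].
have -> : [set w | exists j, lam <= `|walk R b (beta ^~ w) j|] = \bigcup_n F n.
  apply/seteqP; split => w /= [j]; first by exists j => //; exists j.
  by move=> _ [k _ ?]; exists k.
have mF n : measurable (F n) by exact: measurable_max_walk.
have cF : P \o F @ \oo --> P (\bigcup_n F n).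
  apply: nondecreasing_cvg_mu => //; first exact: bigcupT_measurable.
  move=> m n mn; apply/subsetPset => w [j jm ?]; exists j => //.
  exact: leq_trans mn.
rewrite -(cvg_lim _ cF)//; apply: lime_le; first by apply/cvg_ex; eexists; exact: cF.
apply: nearW => n; apply: (le_trans (kolmogorov_maximal_ineq_fin _ _ _ l0)).
by rewrite lee_fin ler_wpM2r ?bV// invr_ge0 exprn_ge0// ltW.
Qed.

End FairBits.

(** * Measurability of convergence sets and of limits *)

(** A Cauchy criterion with countable quantifiers only, hence usable for measurability. Anchoring at
    [u K] matches the maximal events of the walk restarted at [K]. *)
Lemma cvgn_dist_natP {R : realType} (u : nat -> R) :
  cvgn u <-> forall m, exists K, forall j, `|u (K + j)%N - u K| <= m.+1%:R^-1.
Proof.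
split=> [/cvg_ex[/= l ul] m|uC].
  have m0 : 0 < (m.+1%:R^-1 / 2 : R) by rewrite divr_gt0.
  move/cvgrPdist_le : ul => /(_ _ m0)[K _ uK]; exists K => j.
  have := uK _ (leqnn K); have := uK _ (leq_addr j K) => /= h1 h2.
  rewrite (_ : _ - _ = (l - u K) - (l - u (K + j)%N)); last by ring.
  by rewrite (le_trans (ler_normB _ _))// [leRHS]splitr lerD.
apply/cauchy_cvgP/cauchy_exP => e e0.
have [K uK] := uC (Num.truncn e^-1).
exists (u K); exists K => // n /= Kn.
rewrite -ball_normE/= distrC -(subnKC Kn) (le_lt_trans (uK _))//.
by rewrite invf_plt ?posrE// truncnS_gt.
Qed.

Section LimitMeasurability.
Context {R : realType} {d : measure_display} {T : measurableType d}.
Variable h : nat -> T -> R.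
Hypothesis mh : forall n, measurable_fun setT (h n).

Lemma measurable_cvgn : measurable [set w | cvgn (h ^~ w)].
Proof.
have -> : [set w | cvgn (h ^~ w)] = \bigcap_m \bigcup_K \bigcap_j
    [set w | `|h (K + j)%N w - h K w| <= m.+1%:R^-1].
  apply/seteqP; split => w.
    by move=> /cvgn_dist_natP hC m _; have [K hK] := hC m; exists K => // j _; exact: hK.
  move=> hC; apply/cvgn_dist_natP => m; have [K _ hK] := hC m I.
  by exists K => j; exact: hK.
apply: bigcapT_measurable => m; apply: bigcupT_measurable => K.
apply: bigcapT_measurable => j; apply: measurable_set_le => //.
by apply: measurableT_comp => //; exact: measurable_funB.
Qed.

Lemma measurable_limn : measurable_fun setT (fun w => limn (h ^~ w)).
Proof.
pose D := [set w | cvgn (h ^~ w)].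
have mD : measurable D by exact: measurable_cvgn.
rewrite -(setUv D); apply/measurable_funU => //; first exact: measurableC.
split.
  apply: (@measurable_fun_cvg _ _ _ D h) => //.
  by move=> m; apply: measurable_funTS.
(* [limn] takes the default value [point] on divergent sequences. *)
have E : {in ~` D, cst (point : R) =1 (fun w => limn (h ^~ w))}.
  by move=> w; rewrite inE => nD /=; exact/esym/dvgP.
by apply: (eq_measurable_fun (cst (point : R)) E); exact: measurable_cst.
Qed.

End LimitMeasurability.

(** * From convergence in probability to convergence of expectations *)

Section ConvergenceInProbability.
Context {R : realType} {d : measure_display} {T : measurableType d}.
Variable P : probability T R.

Lemma bounded_prob_integrable (g : T -> R) (M : R) : measurable_fun setT g ->
  (forall w, `|g w| <= M) -> P.-integrable setT (EFin \o g).
Proof.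
move=> mg gM; apply: measurable_bounded_integrable => //.
  by rewrite (le_lt_trans (probability_le1 P measurableT))// ltry.
exists M; split; first exact: num_real.
by move=> x Mx w _ /=; rewrite (le_trans (gM w))// ltW.
Qed.

Lemma expectation_Rintegral (g : T -> R) (M : R) : measurable_fun setT g ->
  (forall w, `|g w| <= M) -> 'E_P[g]%E = (\int[P]_w g w)%:E.
Proof.
move=> mg gM; rewrite unlock /Rintegral fineK//.
by apply: integrable_fin_num => //; exact: bounded_prob_integrable gM.
Qed.

(** The set is an uncountable intersection over the displacement [u = z - y]; closedness of each
    member is what makes it measurable. *)
Lemma modulus_set_closed (f : R -> R) (e dl : R) : continuous f ->
  closed [set y | forall z, `|z - y| < dl -> `|f z - f y| <= e].
Proof.
move=> cf; have -> : [set y | forall z, `|z - y| < dl -> `|f z - f y| <= e] =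
    \bigcap_(u in [set u : R | `|u| < dl]) [set y | `|f (y + u) - f y| <= e].
  apply/seteqP; split => y /= yP.
    by move=> u /= udl; apply: yP; rewrite addrAC subrr add0r.
  by move=> z zy; have /= := yP (z - y) zy; rewrite (_ : y + (z - y) = z)//; ring.
apply: closed_bigI => u _.
have -> : [set y | `|f (y + u) - f y| <= e] =
    (fun y => `|f (y + u) - f y|) @^-1` [set x | x <= e] by [].
apply: closed_comp; last exact: closed_le.
move=> y _; apply: (@continuous_comp _ _ _ (fun y => f (y + u) - f y) Num.norm).
  apply: continuousB => //; last exact: cf.
  apply: (@continuous_comp _ _ _ (fun y => y + u) f); last exact: cf.
  by apply: continuousD => //; exact: cst_continuous.
exact: norm_continuous.
Qed.

(** As [f] is continuous but perhaps not uniformly so, two bad events are discarded: [Y] lands where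
    the modulus of continuity is poor at a fixed scale, or [X n] is farther from [Y] than that
    scale. *)
Lemma cvg_expectation_prob (X : nat -> T -> R) (Y : T -> R) (f : R -> R) (M : R) :
  (forall n, measurable_fun setT (X n)) -> measurable_fun setT Y ->
  (forall dl e : R, 0 < dl -> 0 < e ->
    \forall n \near \oo, (P [set w | (dl <= `|X n w - Y w|)%R] <= e%:E)%E) ->
  continuous f -> (forall x, `|f x| <= M) ->
  'E_P[f \o X n]%E @[n --> \oo] --> 'E_P[f \o Y]%E.
Proof.
move=> mX mY XY cf fM.
have mf := continuous_measurable_fun cf.
have mfX n : measurable_fun setT (f \o X n) by exact: measurableT_comp.
have mfY : measurable_fun setT (f \o Y) by exact: measurableT_comp.
have M0 : 0 <= M by apply: le_trans (fM 0).
rewrite (expectation_Rintegral _ M)//=.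
under eq_fun do rewrite (expectation_Rintegral _ M)//=.
apply: cvg_EFin; first exact: nearW.
apply/cvgrPdist_le => e e0 /=.
(* Budget: [c] off the bad events, and at most [2 * M] on each of two events of probability at most
   [c]. *)
pose c := e / (1 + 4 * M).
have c0 : 0 < c by rewrite divr_gt0//; lra.
pose G k := Y @^-1` (~` [set y | forall z, `|z - y| < k.+1%:R^-1 -> `|f z - f y| <= c]).
have mG k : measurable (G k).
  rewrite -[G k]setTI; apply: mY => //; apply: measurableC.
  by apply: closed_measurable; exact: modulus_set_closed.
have [k Gk] : exists k, (P (G k) <= c%:E)%E.
  have : P \o G @ \oo --> P (\bigcap_k G k).
    apply: nonincreasing_cvg_mu => //.
    - by rewrite (le_lt_trans (probability_le1 P _))// ltry.
    - exact: bigcapT_measurable.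
    - move=> m n mn; apply/subsetPset => w; rewrite /G /= => + h; apply => z zy.
      apply: h; rewrite (lt_le_trans zy)// lef_pV2 ?posrE// ler_nat.
      exact: mn.
  rewrite (_ : \bigcap_k G k = set0); last first.
    rewrite -subset0 => w /= GP.
    have /cvgrPdist_le/(_ _ c0)/nbhs_ballP[r /= r0 rf] := cf (Y w).
    apply: (GP (Num.truncn r^-1) I) => z zy.
    rewrite distrC; apply: rf; rewrite -ball_normE/= distrC (lt_trans zy)//.
    by rewrite invf_plt ?posrE// truncnS_gt.
  rewrite measure0 => /fine_cvgP[_ /cvgrPdist_le/(_ _ c0)[N _ NP]].
  exists N; have := NP N (leqnn N); rewrite /= sub0r normrN ger0_norm ?fine_ge0//.
  by rewrite -lee_fin fineK// fin_num_measure.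
near=> n.
have PB : (P [set w | (k.+1%:R^-1 <= `|X n w - Y w|)%R] <= c%:E)%E.
  by near: n; apply: XY => //; rewrite invr_gt0.
set B := [set w | _] in PB.
have mB : measurable B.
  by apply: measurable_set_le => //; apply: measurableT_comp => //; exact: measurable_funB.
have ifX := bounded_prob_integrable _ _ (mfX n) (fun w => fM (X n w)).
have ifY := bounded_prob_integrable _ _ mfY (fun w => fM (Y w)).
have iG : P.-integrable setT (EFin \o (\1_(G k) : T -> R)) by exact: integrable_indic.
have iB : P.-integrable setT (EFin \o (\1_B : T -> R)) by exact: integrable_indic.
have Z (A : set T) : measurable A -> P.-integrable setT (EFin \o (fun w => 2 * M * (\1_A w : R))).
  move=> mA; rewrite (_ : _ \o _ = fun w => ((2 * M)%:E * (\1_A w)%:E)%E)//.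
  by apply: integrableZl => //; exact: integrable_indic.
have iS : P.-integrable setT
    (EFin \o (fun w => 2 * M * (\1_(G k) w : R) + 2 * M * (\1_B w : R))).
  exact: (integrableD measurableT (Z _ (mG k)) (Z _ mB)).
have ic : P.-integrable setT (EFin \o cst c).
  exact: finite_measure_integrable_cst.
have IA (A : set T) : measurable A -> \int[P]_w (2 * M * (\1_A w : R)) = 2 * M * fine (P A).
  move=> mA; rewrite RintegralZl//; last exact: integrable_indic.
  by rewrite /Rintegral integral_indic// setIT.
have f2M w : `|f (Y w) - f (X n w)| <= 2 * M.
  by rewrite (le_trans (ler_normB _ _))// mulr_natl mulr2n lerD.
have iD : P.-integrable setT (EFin \o (fun w => f (Y w) - f (X n w))).
  apply: (bounded_prob_integrable _ _ _ f2M).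
  by apply: measurable_funB; [exact: mfY|exact: mfX].
rewrite -RintegralB//; apply: le_trans (le_normr_Rintegral _ _) _ => //.
apply: (@le_trans _ _ (\int[P]_w (c + (2 * M * \1_(G k) w + 2 * M * \1_B w)))).
  apply: le_Rintegral => //.
  - exact: integrable_norm.
  - exact: (integrableD measurableT ic iS).
  - move=> w _.
    have {}f2M := f2M w.
    have i0 (A : set T) : 0 <= 2 * M * (\1_A w : R).
      by rewrite mulr_ge0// mulr_ge0.
    have [Gw|nGw] := boolP (w \in G k).
      have -> : (\1_(G k) w : R) = 1 by rewrite indicE Gw.
      by have := i0 B; lra.
    have [Bw|nBw] := boolP (w \in B).
      have -> : (\1_B w : R) = 1 by rewrite indicE Bw.
      by have := i0 (G k); lra.
    have := i0 B; have := i0 (G k).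
    suff : `|f (Y w) - f (X n w)| <= c by lra.
    move/negP : nGw; rewrite inE => /contrapT Gw; rewrite distrC; apply: Gw.
    by move/negP : nBw; rewrite inE /B/= => /negP; rewrite -ltNge.
rewrite RintegralD//.
rewrite RintegralD//; [|exact: Z..].
rewrite !IA// Rintegral_cst//= probability_setT/= mulr1.
have fc (A : set T) : measurable A -> (P A <= c%:E)%E -> fine (P A) <= c.
  by move=> mA PA; rewrite -lee_fin fineK// fin_num_measure.
have -> : e = c + (2 * M * c + 2 * M * c).
  by rewrite /c; field; rewrite gt_eqF//; lra.
by rewrite lerD2l lerD// ler_wpM2l ?mulr_ge0// fc.
Unshelve. all: by end_near. Qed.

End ConvergenceInProbability.

(** * Almost sure convergence of sign series and distance to the limit *)

Section FairBitsSeries.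
Context {R : realType} {d : measure_display} {T : measurableType d}.
Variables (P : probability T R) (beta : nat -> T -> bool).
Hypothesis mbeta : forall k, measurable [set w | beta k w].
Hypothesis fair : forall n (e : {ffun 'I_n -> bool}),
  P [set w | forall i : 'I_n, beta i w = e i] = (2 ^- n)%:E.

Local Notation W b w := (walk R b (beta ^~ w)).

Lemma measurable_max_walk_infinite (b : nat -> R) lam :
  measurable [set w | exists j, lam <= `|W b w j|].
Proof.
rewrite [X in measurable X](_ : _ = \bigcup_j [set w | lam <= `|W b w j|]).
  apply: bigcupT_measurable => j; apply: measurable_set_le => //.
  by apply: measurableT_comp => //; exact: measurable_walk.
by apply/seteqP; split => w /= [j]; [exists j|move=> _ ?; exists j].
Qed.

(** Zeroing the first [K] coefficients restarts the walk at time [K], so that the maximal inequality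
    controls all later increments at once. *)
Definition tail_coef (K : nat) (a : nat -> R) i := if (i < K)%N then 0 else a i.

Lemma walk_tail_coef a K j t :
  walk R (tail_coef K a) t (K + j) = walk R a t (K + j) - walk R a t K.
Proof.
rewrite /walk 2!big_split_ord/= addrAC subrr add0r big1 ?add0r.
  by apply: eq_bigr => i _; rewrite /tail_coef ltnNge leq_addr.
by move=> i _; rewrite /tail_coef ltn_ord mul0r.
Qed.

Lemma sum_tail_coef_sqr a K N :
  \sum_(i < N) tail_coef K a i ^+ 2 = \sum_(K <= i < N) a i ^+ 2.
Proof.
have [KN|NK] := leqP K N; last first.
  rewrite big_geq ?(ltnW NK)// big1// => i _; rewrite /tail_coef.
  by rewrite (ltn_trans (ltn_ord i) NK) expr0n.
rewrite -(big_mkord xpredT (fun i => tail_coef K a i ^+ 2)) (big_cat_nat (n := K))//=.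
rewrite big_nat big1 ?add0r; last first.
  by move=> i /andP[_ iK]; rewrite /tail_coef iK expr0n.
rewrite big_nat [RHS]big_nat; apply: eq_bigr => i /andP[Ki _].
by rewrite /tail_coef ltnNge Ki.
Qed.

(** Divergence means that, for some [m], the walk restarted at any [K] reaches the level 1/(m+1).
    The maximal inequality bounds this by the tail of squares after [K], which is arbitrarily
    small. *)
Lemma walk_cvg_ae (a : nat -> R) :
  (forall e, 0 < e -> exists K, forall N, \sum_(K <= i < N) a i ^+ 2 <= e) ->
  P.-negligible [set w | ~ cvgn (W a w)].
Proof.
move=> a2.
pose A m K := [set w | exists j, m.+1%:R^-1 <= `|W (tail_coef K a) w j|].
have mA m K : measurable (A m K) by exact: measurable_max_walk_infinite.
apply: (@negligibleS _ _ _ _ (\bigcup_m \bigcap_K A m K)).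
  move=> w /= nc; apply: contrapT => nA; apply: nc; apply/cvgn_dist_natP => m.
  apply: contrapT => /forallNP h; apply: nA; exists m => // K _.
  have /existsNP[j /negP] := h K; rewrite -ltNge => hj.
  by exists (K + j)%N; rewrite walk_tail_coef ltW.
apply: negligible_bigcup => m; exists (\bigcap_K A m K); split => //.
  exact: bigcapT_measurable.
apply/eqP; rewrite eq_le measure_ge0 andbT; apply/lee_addgt0Pr => e e0.
rewrite add0e.
pose l : R := m.+1%:R^-1.
have l0 : 0 < l by rewrite invr_gt0.
(* The factor [l ^+ 2] cancels the division in the maximal inequality. *)
have [K aK] := a2 (e * l ^+ 2) (mulr_gt0 e0 (exprn_gt0 2 l0)).
apply: (@le_trans _ _ (P (A m K))).
  apply: le_measure; rewrite ?inE//; first exact: bigcapT_measurable.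
  by move=> w /(_ K I).
rewrite (_ : e = e * l ^+ 2 / l ^+ 2); last by rewrite mulfK// gt_eqF// exprn_gt0.
by apply: kolmogorov_maximal_ineq => // N; rewrite sum_tail_coef_sqr.
Qed.

(** Since [c] vanishes from [n] on, [W c w n - W a w j] is the walk with coefficients [c - a] at
    every time [j >= n]. One maximal inequality for it therefore bounds the distance to the
    limit. *)
Lemma prob_dist_limn_walk (a c : nat -> R) n V dl : 0 < dl ->
  (forall e, 0 < e -> exists K, forall N, \sum_(K <= i < N) a i ^+ 2 <= e) ->
  (forall i, (n <= i)%N -> c i = 0) ->
  (forall N, \sum_(i < N) (c i - a i) ^+ 2 <= V) ->
  (P [set w | (2 * dl <= `|W c w n - limn (W a w)|)%R] <= (V / dl ^+ 2)%:E)%E.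
Proof.
move=> dl0 a2 c0 caV.
pose D := [set w | cvgn (W a w)].
have mD : measurable D.
  apply: (measurable_cvgn (fun n w => W a w n)) => k; exact: measurable_walk.
have PD : P (~` D) = 0%E.
  by apply: measure_negligible; [exact: measurableC|exact: walk_cvg_ae].
pose A := [set w | exists j, dl <= `|W (fun i => c i - a i) w j|].
have mA : measurable A by exact: measurable_max_walk_infinite.
have mY : measurable_fun setT (fun w => limn (W a w)).
  by apply: (measurable_limn (fun n w => W a w n)) => k; exact: measurable_walk.
have PA : (P A <= (V / dl ^+ 2)%:E)%E by exact: kolmogorov_maximal_ineq.
apply: (@le_trans _ _ (P A + P (~` D))%E); last by rewrite PD adde0.
apply: (@le_trans _ _ (P (A `|` ~` D))); last first.
  by apply: measureU2 => //; exact: measurableC.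
apply: le_measure; rewrite ?inE//.
- apply: measurable_set_le => //; apply: measurableT_comp => //.
  by apply: measurable_funB => //; exact: measurable_walk.
- by apply: measurableU => //; exact: measurableC.
move=> w /= h; have [Dw|] := pselect (D w); last by right.
left; apply: contrapT => /forallNP nA.
(* Values below [dl] have a limit that is only at most [dl]; the factor 2 in the event leaves room
   for this. *)
suff : `|W c w n - limn (W a w)| <= dl by lra.
have : (fun j => `|W c w n - W a w j|) @ \oo --> `|W c w n - limn (W a w)|.
  by apply: cvg_norm; apply: cvgB => //; exact: cvg_cst.
move=> /cvg_lim <-//; apply: limr_le.
  apply: is_cvg_norm; apply: is_cvgB => //; exact: is_cvg_cst.
exists n => // j /= nj.
have -> : W c w n - W a w j = W (fun i => c i - a i) w j.
  rewrite /walk -(subnKC nj) 2!big_split_ord/=.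
  rewrite opprD addrA -sumrB; congr (_ + _).
    by apply: eq_bigr => i _; rewrite mulrBl.
  rewrite -sumrN; apply: eq_bigr => i _.
  by rewrite c0 ?leq_addr// sub0r mulNr.
by have /negP := nA j; rewrite -ltNge => /ltW.
Qed.

(* The signs are exchangeable, so reversing the coefficients preserves the law. *)
Lemma expectation_walk_rev (c : nat -> R) (f : R -> R) n :
  'E_P[fun w => f (\sum_(i < n) c (n - i.+1)%N * sgn_of R (beta i w))%R]%E =
  'E_P[fun w => f (W c w n)]%E.
Proof.
rewrite unlock.
transitivity (\int[P]_w (f (\sum_(i < n) c (n - i.+1)%N * sgn_of R (obs beta n w i))%R)%:E)%E.
  by apply: eq_integral => w _; congr (_%:E); congr f; apply: eq_bigr => i _; rewrite ffunE.
rewrite (integral_obs P _ mbeta fair n (fun e => f (\sum_(i < n) c (n - i.+1)%N * sgn_of R (e i)))).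
transitivity (\int[P]_w (f (\sum_(i < n) c i * sgn_of R (obs beta n w i))%R)%:E)%E; last first.
  by apply: eq_integral => w _; congr (_%:E); congr f; apply: eq_bigr => i _; rewrite ffunE.
rewrite (integral_obs P _ mbeta fair n (fun e => f (\sum_(i < n) c i * sgn_of R (e i)))).
congr ((_ / _)%:E).
pose r (e : {ffun 'I_n -> bool}) := [ffun i => e (rev_ord i)].
have rK : involutive r by move=> e; apply/ffunP => i; rewrite !ffunE rev_ordK.
rewrite [RHS](reindex_inj (inv_inj rK))/=; apply: eq_bigr => e _; congr f.
rewrite [RHS](reindex_inj rev_ord_inj)/=; apply: eq_bigr => i _.
by rewrite ffunE rev_ordK.
Qed.

End FairBitsSeries.

(** * Square-summable limits of coefficient arrays *)

Lemma ler_sum_sqr_nat {R : realType} (u : nat -> R) (K N N' : nat) : (N <= N')%N ->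
  \sum_(K <= i < N) u i ^+ 2 <= \sum_(K <= i < N') u i ^+ 2.
Proof.
move=> NN'; have [NK|KN] := leqP N K.
  by rewrite [leLHS]big_geq// sumr_ge0// => i _; exact: sqr_ge0.
rewrite [leRHS](big_cat_nat (n := N))//=; last exact: ltnW.
by rewrite lerDl sumr_ge0// => i _; exact: sqr_ge0.
Qed.

Section SquareSummableLimit.
Context {R : realType}.
Variables (a : nat -> R) (c : nat -> nat -> R).
Hypothesis ca : forall i, c n i @[n --> \oo] --> a i.
Hypothesis c2 : forall e : R, 0 < e ->
  exists K, forall n, \sum_(K <= i < n) c n i ^+ 2 <= e.

Lemma cvg_sum_nat (u : nat -> nat -> R) (v : nat -> R) K N :
  (forall i, u n i @[n --> \oo] --> v i) ->
  \sum_(K <= i < N) u n i @[n --> \oo] --> \sum_(K <= i < N) v i.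
Proof.
move=> uv; elim: N => [|N IH].
  by rewrite big_geq//; under eq_fun do rewrite big_geq//; exact: cvg_cst.
have [NK|KN] := ltnP N K.
  by rewrite big_geq//; under eq_fun do rewrite big_geq//; exact: cvg_cst.
by rewrite big_nat_recr//=; under eq_fun do rewrite big_nat_recr//=; exact: cvgD.
Qed.

(** Fatou's lemma for finite sums: for fixed [N], the limit in [n] is taken termwise, and the
    uniform bound applies once [n >= N]. *)
Lemma limit_sqr_tail e : 0 < e ->
  exists K, forall N, \sum_(K <= i < N) a i ^+ 2 <= e.
Proof.
move=> /c2[K cK]; exists K => N.
have : \sum_(K <= i < N) c n i ^+ 2 @[n --> \oo] --> \sum_(K <= i < N) a i ^+ 2.
  apply: (cvg_sum_nat (fun n i => c n i ^+ 2)) => i.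
  by rewrite expr2; under eq_fun do rewrite expr2; exact: cvgM.
move=> cN; rewrite -(cvg_lim _ cN)//; apply: limr_le.
  by apply/cvg_ex; eexists; exact: cN.
by exists N => // n /= Nn; apply: le_trans (cK n); exact: ler_sum_sqr_nat.
Qed.

(** Dominated convergence in square mean: the finitely many head terms converge, and both tails are
    uniformly small. The array is cut off at [n] because the hypothesis bounds it only there. *)
Lemma sqr_dist_limit e : 0 < e -> \forall n \near \oo, forall N,
  \sum_(i < N) ((if (i < n)%N then c n i else 0) - a i) ^+ 2 <= e.
Proof.
(* One fifth for the head; the tail costs four, since (x-y)^2 <= 2x^2 + 2y^2 with one fifth for each
   sum of squares. *)
move=> e0; have e5 : 0 < e / 5 by rewrite divr_gt0.
have [K1 cK1] := c2 _ e5; have [K2 aK2] := limit_sqr_tail _ e5.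
pose K := maxn K1 K2.
have sumS (u : nat -> R) k l N : (k <= l)%N ->
    \sum_(l <= i < N) u i ^+ 2 <= \sum_(k <= i < N) u i ^+ 2.
  move=> kl; have [Nl|lN] := leqP N l.
    by rewrite [leLHS]big_geq// sumr_ge0// => i _; exact: sqr_ge0.
  rewrite [leRHS](big_cat_nat (n := l))//=; last exact: ltnW.
  by rewrite lerDr sumr_ge0// => i _; exact: sqr_ge0.
have cK n : \sum_(K <= i < n) c n i ^+ 2 <= e / 5.
  by apply: le_trans (cK1 n); apply: sumS; exact: leq_maxl.
have aK N : \sum_(K <= i < N) a i ^+ 2 <= e / 5.
  by apply: le_trans (aK2 N); apply: sumS; exact: leq_maxr.
have : \sum_(0 <= i < K) (c n i - a i) ^+ 2 @[n --> \oo] --> (0 : R).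
  have := cvg_sum_nat (fun n i => (c n i - a i) ^+ 2) (fun i => (a i - a i) ^+ 2) 0 K.
  rewrite [X in _ --> X]big1; last by move=> i _; rewrite subrr expr0n.
  apply => i; rewrite expr2; under eq_fun do rewrite expr2.
  by apply: cvgM; apply: cvgB => //; exact: cvg_cst.
move=> /cvgrPdist_le/(_ _ e5)[n0 _ n0P].
exists (maxn n0 K) => // n /=; rewrite geq_max => /andP[n0n Kn] N.
pose c' i := if (i < n)%N then c n i else 0.
rewrite -(big_mkord xpredT (fun i => (c' i - a i) ^+ 2)).
apply: le_trans (ler_sum_sqr_nat (fun i => c' i - a i) _ _ _ (leq_maxr K N)) _.
rewrite (big_cat_nat (n := K)) ?leq_maxl//=.
have h1 : \sum_(0 <= i < K) (c' i - a i) ^+ 2 <= e / 5.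
  have := n0P n n0n; rewrite /= sub0r normrN; apply: le_trans.
  apply: le_trans (ler_norm _); rewrite le_eqVlt; apply/orP; left; apply/eqP.
  apply: eq_big_nat => i /andP[_ iK].
  by rewrite /c' (leq_trans iK Kn).
have h2 N' : \sum_(K <= i < N') c' i ^+ 2 <= e / 5.
  apply: le_trans (cK n).
  have : \sum_(K <= i < n) c n i ^+ 2 = \sum_(K <= i < maxn n N') c' i ^+ 2.
    rewrite [RHS](big_cat_nat (n := n)) ?leq_maxl//=.
    rewrite [X in _ + X]big_nat [X in _ + X]big1 ?addr0.
      by apply: eq_big_nat => i /andP[_ ni]; rewrite /c' ni.
    by move=> i /andP[ni _]; rewrite /c' ltnNge ni/= expr0n.
  by move=> ->; apply: ler_sum_sqr_nat; exact: leq_maxr.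
have h3 : \sum_(K <= i < maxn K N) (c' i - a i) ^+ 2 <=
    \sum_(K <= i < maxn K N) (2 * c' i ^+ 2 + 2 * a i ^+ 2).
  apply: ler_sum => i _; rewrite -subr_ge0.
  by rewrite (_ : _ - _ = (c' i + a i) ^+ 2) ?sqr_ge0//; ring.
move: h3; rewrite big_split/= -!mulr_sumr.
by have := h2 (maxn K N); have := aK (maxn K N); lra.
Qed.

End SquareSummableLimit.

(** * Limit of the walks with reversed coefficients *)

Section ReversedWalkLimit.
Context {R : realType} {d : measure_display} {T : measurableType d}.
Variables (P : probability T R) (beta : nat -> T -> bool).
Hypothesis mbeta : forall k, measurable [set w | beta k w].
Hypothesis fair : forall n (e : {ffun 'I_n -> bool}),
  P [set w | forall i : 'I_n, beta i w = e i] = (2 ^- n)%:E.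
Variables (a : nat -> R) (c : nat -> nat -> R).
Hypothesis ca : forall i, c n i @[n --> \oo] --> a i.
Hypothesis c2 : forall e : R, 0 < e ->
  exists K, forall n, \sum_(K <= i < n) c n i ^+ 2 <= e.

(** At each [n] the law is first exchanged for that of the walk in natural order, which lives on the
    same bits as the limiting series and converges to it in probability. *)
Lemma cvg_reversed_walk (f : R -> R) M : continuous f -> (forall x, `|f x| <= M) ->
  'E_P[fun w => f (\sum_(i < n) c n (n - i.+1)%N * sgn_of R (beta i w))%R]%E
    @[n --> \oo] --> 'E_P[fun w => f (limn (walk R a (beta ^~ w)))]%E.
Proof.
move=> cf fM.
pose c' n i := if (i < n)%N then c n i else 0.
have E n : 'E_P[fun w => f (\sum_(i < n) c n (n - i.+1)%N * sgn_of R (beta i w))%R]%E =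
    'E_P[f \o (fun w => walk R (c' n) (beta ^~ w) n)]%E.
  rewrite -(expectation_walk_rev P beta mbeta fair (c' n) f n).
  congr expectation; apply/funext => w; congr f; apply: eq_bigr => i _.
  by rewrite /c' ltn_subrL/= (leq_trans _ (ltn_ord i)).
under eq_fun do rewrite E.
apply: (cvg_expectation_prob P _ _ f M) => //.
- by move=> n; exact: measurable_walk.
- by apply: (measurable_limn (fun n w => walk R a (beta ^~ w) n)) => k; exact: measurable_walk.
move=> dl e dl0 e0.
have h0 : 0 < e * (dl / 2) ^+ 2 by rewrite mulr_gt0// exprn_gt0// divr_gt0.
have [n0 _ n0P] := sqr_dist_limit a c ca c2 _ h0.
exists n0 => // n /= n0n.
rewrite (_ : e = e * (dl / 2) ^+ 2 / (dl / 2) ^+ 2); last first.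
  by rewrite mulfK// gt_eqF// exprn_gt0// divr_gt0.
rewrite [X in P X](_ : _ = [set w | 2 * (dl / 2) <=
    `|walk R (c' n) (beta ^~ w) n - limn (walk R a (beta ^~ w))|]); last first.
  by rewrite mulrC divfK.
apply: prob_dist_limn_walk => //.
- by rewrite divr_gt0.
- exact: (limit_sqr_tail a c ca c2).
- by move=> i ni; rewrite /c' ltnNge ni.
- exact: n0P.
Qed.

End ReversedWalkLimit.

(** * From independent Rademacher signs to fair bits *)

Section RademacherBits.
Context {R : realType} {d : measure_display} {T : measurableType d}.
Variables (P : probability T R) (xi : nat -> T -> R).
Hypothesis mxi : forall k, measurable_fun setT (xi k).
Hypothesis ixi : mutually_independent P xi [set k | (1 <= k)%N].
Hypothesis rxi : forall k, (1 <= k)%N -> rademacher P (xi k).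

(* Bits are indexed from 0, the signs from 1. *)
Definition xi_bit (k : nat) (w : T) : bool := xi k.+1 w == 1.

Lemma measurable_xi_preimage k (B : set R) : measurable B -> measurable (xi k @^-1` B).
Proof. by move=> mB; rewrite -[X in measurable X]setTI; exact: mxi. Qed.

Lemma measurable_xi_bit k : measurable [set w | xi_bit k w].
Proof.
rewrite (_ : [set w | _] = xi k.+1 @^-1` [set 1]); first exact: measurable_xi_preimage.
by apply/seteqP; split => w /eqP.
Qed.

Lemma fair_xi_bit n (e : {ffun 'I_n -> bool}) :
  P [set w | forall i : 'I_n, xi_bit i w = e i] = (2 ^- n)%:E.
Proof.
(* A false bit corresponds to the complement of [[set 1]], as in [xi_bit], so the events match
   everywhere and not just almost everywhere. The predecessor undoes the shift of indices. *)
pose B k := if bits n e k.-1 then [set (1 : R)] else ~` [set 1].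
have mB k : measurable (B k).
  by rewrite /B; case: ifPn => _ //; exact: measurableC.
have J1 k : k \in iota 1 n -> [set k | (1 <= k)%N] k.
  by rewrite mem_iota => /andP[].
have -> : [set w | forall i : 'I_n, xi_bit i w = e i] =
    \bigcap_(k in [set` iota 1 n]) (xi k @^-1` B k).
  apply/seteqP; split => w /=.
    move=> ew k /=; rewrite mem_iota add1n ltnS => /andP[k0 kn].
    have kn' : (k.-1 < n)%N by rewrite prednK.
    have := ew (Ordinal kn'); rewrite -bitsE /xi_bit/= prednK// /B.
    by case: (bits n e k.-1) => [/eqP//|/negbT/eqP].
  move=> wB i; have /= := wB i.+1; rewrite mem_iota add1n !ltnS leq0n ltn_ord.
  move=> /(_ isT); rewrite /B/= bitsE /xi_bit; case: (e i); first by move/eqP.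
  by move/eqP/negbTE.
rewrite (ixi (iota 1 n) (iota_uniq _ _) J1 B mB).
have PB k : (1 <= k)%N -> P (xi k @^-1` B k) = (2^-1)%:E.
  move=> k1; have [p1 _] := rxi k k1; rewrite /B; case: ifPn => _.
    by rewrite p1 div1r.
  rewrite -preimage_setC probability_setC; last exact: measurable_xi_preimage.
  by rewrite p1 -EFinB; congr (_%:E); field.
rewrite (eq_big_seq (fun=> (2^-1)%:E)); last by move=> k /J1; exact: PB.
rewrite big_const_seq count_predT size_iota -exprVn.
by elim: n {e B mB J1 PB} => [//|n IH] /=; rewrite IH -EFinM exprS.
Qed.

Lemma xi_sgn_ae : P.-negligible [set w | ~ forall k, xi k.+1 w = sgn_of R (xi_bit k w)].
Proof.
apply: (@negligibleS _ _ _ _ (\bigcup_k (xi k.+1 @^-1` (~` [set 1; -1])))).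
  move=> w /= /existsNP[k nk]; exists k => // -[] /= kE; apply: nk.
    by rewrite /xi_bit /sgn_of kE eqxx.
  by rewrite /xi_bit /sgn_of kE ifF//; apply/eqP; lra.
apply: negligible_bigcup => k.
have m2 : measurable [set (1 : R); -1] by exact: measurableU.
have mk := measurable_xi_preimage k.+1 _ m2.
rewrite -preimage_setC.
suff : P (~` (xi k.+1 @^-1` [set 1; -1])) = 0%E.
  by move/negligibleP; apply; exact: measurableC.
rewrite probability_setC// preimage_setU measureU.
- have [p1 p2] := rxi k.+1 isT.
  by rewrite [X in (_ - (X + _))%E]p1 [X in (_ - (_ + X))%E]p2 -EFinD -splitr subrr.
- exact: measurable_xi_preimage.
- exact: measurable_xi_preimage.
- by rewrite -subset0 => w /= [-> x1]; exfalso; lra.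
Qed.

(** The signs take the values 1 and -1 only almost surely; this transfers expectations to the bits
    across that null set. *)
Lemma expectation_ae_bits (X Y : T -> R) (f : R -> R) : continuous f ->
  measurable_fun setT X -> measurable_fun setT Y ->
  (forall w, (forall k, xi k.+1 w = sgn_of R (xi_bit k w)) -> X w = Y w) ->
  'E_P[f \o X]%E = 'E_P[fun w => f (Y w)]%E.
Proof.
move=> cf mX mY XY; have mf := continuous_measurable_fun cf.
rewrite unlock; apply: ae_eq_integral => //.
- by apply/measurable_EFinP; exact: measurableT_comp.
- by apply/measurable_EFinP; apply: (measurableT_comp mf mY).
apply: negligibleS xi_sgn_ae => w /= h hk; apply: h => _.
by rewrite XY.
Qed.

(** All the probability ends here: what remains concerns only the deterministic coefficients. *)
Lemma cvg_in_distribution_coef (sigma H : R) :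
  (forall k, j_nH sigma H n.+1 (n - k) @[n --> \oo] -->
     2 * g_H sigma H * rho (h_of H) k.+1) ->
  (forall e : R, 0 < e -> exists K, forall n,
     \sum_(K <= k < n) j_nH sigma H n.+1 (n - k) ^+ 2 <= e) ->
  cvg_in_distribution P (Yn sigma H xi) (YH sigma H xi).
Proof.
(* After the shift, [Yn] at [n.+1] has exactly [n] terms, and reading [c n] backwards restores its
   order. *)
move=> ca c2 f cf [M fM]; rewrite -cvg_shiftS/=.
pose a k := 2 * g_H sigma H * rho (h_of H) k.+1.
pose c n k := j_nH sigma H n.+1 (n - k).
have mw b k : measurable_fun setT (fun w => walk R b (xi_bit ^~ w) k).
  exact/measurable_walk/measurable_xi_bit.
have YHE : 'E_P[f \o YH sigma H xi]%E = 'E_P[fun w => f (limn (walk R a (xi_bit ^~ w)))]%E.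
  apply: expectation_ae_bits => //.
  - apply: (measurable_limn (Ypartial sigma H xi)) => N.
    apply: measurable_funM => //; apply: measurable_sum => k.
    by apply: measurable_funM => //; exact: mxi.
  - by apply: (measurable_limn (fun n w => walk R a (xi_bit ^~ w) n)).
  - move=> w wP; rewrite /YH; congr (lim (_ @ \oo)); apply/funext => N.
    rewrite /Ypartial /walk big_add1/= big_mkord mulr_sumr.
    by apply: eq_bigr => i _; rewrite wP mulrA.
have YnE n : 'E_P[f \o Yn sigma H xi n.+1]%E =
    'E_P[fun w => f (\sum_(i < n) c n (n - i.+1)%N * sgn_of R (xi_bit i w))%R]%E.
  apply: expectation_ae_bits => //.
  - by apply: measurable_sum => k; apply: measurable_funM => //; exact: mxi.
  - have := mw (fun i => c n (n - i.+1)%N) n; exact.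
  - move=> w wP; rewrite /Yn big_add1/= big_mkord; apply: eq_bigr => i _.
    by rewrite wP /c subKn.
rewrite YHE; under eq_fun do rewrite YnE.
apply: (cvg_reversed_walk P xi_bit _ _ a c ca c2 f M) => //.
- exact: measurable_xi_bit.
- exact: fair_xi_bit.
Qed.

End RademacherBits.

(** * Comparison of nonnegative integrals without measurability *)

Section NonnegativeIntegrals.
Context {d : measure_display} {T : measurableType d} {R : realType}.
Variable mu : {measure set T -> \bar R}.

(* The integral of a nonnegative function is a supremum over simple functions,
   hence monotone even without measurability. *)
Lemma ge0_le_integral_nonmeasurable (D : set T) (f g : T -> \bar R) :
  (forall x, D x -> 0 <= f x)%E -> (forall x, D x -> f x <= g x)%E ->
  (\int[mu]_(x in D) f x <= \int[mu]_(x in D) g x)%E.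
Proof.
move=> f0 fg; rewrite !ge0_integralE//; last first.
  by move=> x Dx; exact: le_trans (f0 _ Dx) (fg _ Dx).
apply: ereal_sup_le => _ [h hf <-]; exists h => // x.
apply: le_trans (hf x) _; rewrite !patchE; case: ifPn => // xD.
by apply: fg; exact: set_mem.
Qed.

(** [Rintegral] sends an infinite integral to 0, so monotonicity requires a finite upper integral.
    Finiteness of the smaller one is returned as well, for chained comparisons. *)
Lemma ge0_le_Rintegral (D : set T) (f g : T -> R) :
  (forall x, D x -> 0 <= f x <= g x) -> (\int[mu]_(x in D) (g x)%:E < +oo)%E ->
  (\int[mu]_(x in D) (f x)%:E < +oo)%E /\
  \int[mu]_(x in D) f x <= \int[mu]_(x in D) g x.
Proof.
move=> fg goo.
have f0 x : D x -> (0 <= (f x)%:E)%E by move=> /fg /andP[]; rewrite lee_fin.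
have le : (\int[mu]_(x in D) (f x)%:E <= \int[mu]_(x in D) (g x)%:E)%E.
  by apply: ge0_le_integral_nonmeasurable => // x /fg /andP[_]; rewrite lee_fin.
have foo := le_lt_trans le goo; split => //.
have I0 := integral_ge0 mu f0; have J0 := le_trans I0 le.
by rewrite /Rintegral fine_le// ge0_fin_numE.
Qed.

End NonnegativeIntegrals.

(** * Power integrals with an endpoint singularity *)

Section LeftSingularFTC.
Context {R : realType}.
Local Notation leb := (@lebesgue_measure R).

(** The integrand may blow up at [a] while [F] stays continuous there: the usual theorem applies on
    [[a_ n, b]], and monotone convergence handles [a_ n] tending to [a]. *)
Lemma FTC2_left_singular (f F : R -> R) (a b : R) : a < b ->
  (forall x, a < x -> 0 <= f x) ->
  (forall x, a < x -> {for x, continuous f}) ->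
  (forall x, a < x -> is_derive x 1 F (f x)) -> continuous F ->
  (\int[leb]_(x in `[a, b]) (f x)%:E = (F b - F a)%:E)%E.
Proof.
move=> ab f0 cf dF cF.
have mf : measurable_fun `]a, +oo[ f.
  apply: open_continuous_measurable_fun => //.
  by move=> x; rewrite inE/= in_itv/= andbT => /cf.
have mfab : measurable_fun `]a, b] f.
  by apply: measurable_funS mf => // x /=; rewrite !in_itv/= => /andP[->].
rewrite -integral_itv_obnd_cbnd; last exact/measurable_EFinP.
(* With [n.+1] the first point would be [b] itself. *)
pose a_ n := a + (b - a) / n.+2%:R.
have aa n : a < a_ n by rewrite ltrDl divr_gt0// subr_gt0.
have ab_ n : a_ n < b.
  by rewrite -ltrBrDl ltr_pdivrMr// ltr_pMr ?subr_gt0// ltr1n.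
have a_cvg : a_ @ \oo --> a.
  rewrite -[X in _ --> X]addr0; apply: cvgD; first exact: cvg_cst.
  rewrite -[X in _ --> X](mulr0 (b - a)); apply: cvgM; first exact: cvg_cst.
  have := @cvg_harmonic R; rewrite -cvg_shiftS; exact.
have -> : `]a, b]%classic = \bigcup_n `[a_ n, b]%classic.
  apply/seteqP; split => x /=; rewrite in_itv/=.
    move=> /andP[ax xb].
    have /cvgrPdist_lt/(_ (x - a)) := a_cvg; rewrite subr_gt0 => /(_ ax)[n _ nP].
    exists n => //=; rewrite in_itv/= xb andbT.
    have := nP n (leqnn n); rewrite /= distrC gtr0_norm ?subr_gt0// ltrD2r.
    exact: ltW.
  by move=> [n _]; rewrite /= in_itv/= => /andP[anx ->]; rewrite (lt_le_trans (aa n)).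
have cvg1 : (\int[leb]_(x in `[a_ n, b]) (f x)%:E)%E @[n --> \oo] -->
   (\int[leb]_(x in \bigcup_n `[a_ n, b]%classic) (f x)%:E)%E.
  apply: ge0_nondecreasing_set_cvg_integral => //.
  - move=> m n mn; apply/subsetPset => x /=; rewrite !in_itv/= => /andP[h ->].
    rewrite andbT (le_trans _ h)// lerD2l ler_wpM2l//; first by rewrite subr_ge0 ltW.
    by rewrite lef_pV2 ?posrE// ler_nat !ltnS.
  - move=> n; apply/measurable_EFinP; apply: measurable_funS mf => // x /=.
    by rewrite !in_itv/= andbT => /andP[h _]; exact: lt_le_trans h.
  - move=> n x /=; rewrite in_itv/= => /andP[h _]; rewrite lee_fin f0//.
    exact: lt_le_trans h.
have E n : (\int[leb]_(x in `[a_ n, b]) (f x)%:E)%E = (F b - F (a_ n))%:E.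
  rewrite (@continuous_FTC2 _ f F)// ?EFinB//.
  - apply: continuous_in_subspaceT => x; rewrite inE/= in_itv/= => /andP[h _].
    by apply: cf; exact: lt_le_trans h.
  - split.
    + by move=> x; rewrite in_itv/= => /andP[h _]; have [] := dF x (lt_trans (aa n) h).
    + exact/cvg_at_right_filter/cF.
    + exact/cvg_at_left_filter/cF.
  - move=> x; rewrite in_itv/= => /andP[h _]; rewrite derive1E.
    by have [_ ->] := dF x (lt_trans (aa n) h).
move: cvg1; under eq_fun do rewrite E.
move=> /cvg_lim <-//; apply/cvg_lim => //.
apply: cvg_EFin; first exact: nearW.
by apply: cvgB; [exact: cvg_cst|apply: continuous_cvg => //; exact: cF].
Qed.

(** The modulus makes the power continuous on the whole line, as [FTC2_left_singular] asks of an
    antiderivative. *)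
Lemma norm_powR_continuous (p : R) : 0 < p -> continuous (fun x : R => `|x| `^ p).
Proof.
move=> p0 x; have [->|x0] := eqVneq x 0.
  apply/cvgrPdist_le => e e0; rewrite normr0 powR0 ?gt_eqF//.
  near=> y; rewrite sub0r normrN ger0_norm ?powR_ge0//.
  rewrite -[leRHS](@powRr1 _ e) ?(ltW e0)// -(mulVf (lt0r_neq0 p0)) powRrM.
  apply: ge0_ler_powR; rewrite ?nnegrE ?powR_ge0//; first exact: ltW.
  rewrite -[y]subr0 distrC; near: y.
  have : id y @[y --> (0 : R)] --> (0 : R) by exact: cvg_id.
  by move=> /cvgrPdist_le; apply; exact: powR_gt0.
have h : {for `|x|, continuous (@powR R ^~ p)}.
  apply/differentiable_continuous/derivable1_diffP/derivable_powR.
  by rewrite in_itv/= andbT normr_gt0.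
exact: (continuous_comp (@norm_continuous _ R x) h).
Unshelve. all: by end_near. Qed.

Lemma is_derive_norm_powR (p x : R) : 0 < x ->
  is_derive x 1 (fun x : R => `|x| `^ p) (p * `|x| `^ (p - 1)).
Proof.
move=> x0; rewrite gtr0_norm//.
apply: (@near_eq_is_derive _ _ _ (@powR R ^~ p)); last exact: is_derive1_powR.
by near=> y; rewrite gtr0_norm//; near: y; exact: lt_nbhsr.
Unshelve. all: by end_near. Qed.

Lemma is_derive_shift (c x : R) : is_derive x 1 (fun x : R => x + c) 1.
Proof.
have := is_deriveD (is_derive_id x 1) (is_derive_cst c x 1).
by rewrite addr0.
Qed.

Lemma is_derive_revshift (c x : R) : is_derive x 1 (fun x : R => c - x) (-1).
Proof.
have := is_deriveB (is_derive_cst c x 1) (is_derive_id x 1).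
by rewrite sub0r.
Qed.

Lemma integral_powR_shift (a b c p : R) : 0 <= a + c -> a < b -> 0 < p ->
  (\int[leb]_(x in `[a, b]) ((x + c) `^ (p - 1))%:E =
   (((b + c) `^ p - (a + c) `^ p) / p)%:E)%E.
Proof.
move=> ac ab p0.
pose F x := p^-1 * `|x + c| `^ p.
have xc x : a < x -> 0 < x + c by move=> ax; lra.
transitivity (F b - F a)%:E; last first.
  congr (_%:E).
  by rewrite /F !ger0_norm -?mulrBr 1?mulrC//; lra.
apply: (@FTC2_left_singular _ F) => //.
- by move=> x _; exact: powR_ge0.
- move=> x /xc x0; apply/differentiable_continuous/derivable1_diffP.
  have := @is_derive1_comp R _ (fun x => x + c) x _ _ (is_derive1_powR (p - 1) x0) (is_derive_shift c x).
  by case.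
- move=> x /xc x0.
  have h0 := @is_derive1_comp R _ (fun x => x + c) x _ _
    (is_derive_norm_powR p _ x0) (is_derive_shift c x).
  have h : is_derive x 1 F (p^-1 *: (p * `|x + c| `^ (p - 1) * 1)).
    exact: (is_deriveZ p^-1 h0).
  apply: (@is_derive_eq _ _ _ _ _ _ _ _ h).
  by rewrite mulr1 gtr0_norm// /GRing.scale/= mulKf// gt_eqF.
- move=> x; apply: cvgM; first exact: cvg_cst.
  apply: (@continuous_comp _ _ _ (fun x => x + c) (fun x : R => `|x| `^ p)).
    by apply: cvgD; [exact: cvg_id|exact: cvg_cst].
  exact: norm_powR_continuous.
Qed.

Lemma integral_powR_revshift (a b c p : R) : b <= c -> a < b -> 0 < p ->
  (\int[leb]_(x in `[a, b]) ((c - x) `^ p)%:E =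
   (((c - a) `^ (p + 1) - (c - b) `^ (p + 1)) / (p + 1))%:E)%E.
Proof.
move=> bc ab p0; have p1 : 0 < p + 1 by lra.
pose F x := - (p + 1)^-1 * `|c - x| `^ (p + 1).
have cont q : 0 < q -> continuous (fun x : R => `|c - x| `^ q).
  move=> q0 x.
  apply: (@continuous_comp _ _ _ (fun x => c - x) (fun x : R => `|x| `^ q)).
    by apply: cvgB; [exact: cvg_cst|exact: cvg_id].
  exact: norm_powR_continuous.
have cF : continuous F.
  by move=> x; apply: cvgM; [exact: cvg_cst|exact: cont].
transitivity (\int[leb]_(x in `[a, b]) (`|c - x| `^ p)%:E)%E.
  by apply: eq_integral => x; rewrite inE/= in_itv/= => /andP[_ xb]; rewrite ger0_norm//; lra.
have dF x : x < b -> is_derive x 1 F (`|c - x| `^ p).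
  move=> xb; have x0 : 0 < c - x by lra.
  have h0 := @is_derive1_comp R _ (fun x => c - x) x _ _
    (is_derive_norm_powR (p + 1) _ x0) (is_derive_revshift c x).
  have h : is_derive x 1 F
      (- (p + 1)^-1 *: ((p + 1) * `|c - x| `^ (p + 1 - 1) * -1)).
    exact: (is_deriveZ (- (p + 1)^-1) h0).
  apply: (@is_derive_eq _ _ _ _ _ _ _ _ h).
  by rewrite addrK /GRing.scale/= mulrN1 mulrNN mulKf// gt_eqF.
rewrite (@continuous_FTC2 _ _ F)//.
- rewrite -EFinB; congr (_%:E); rewrite /F !ger0_norm; [|lra..].
  by ring.
- by apply: continuous_subspaceT; exact: cont.
- split.
  + by move=> x; rewrite in_itv/= => /andP[_ /dF] [].
  + exact/cvg_at_right_filter/cF.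
  + exact/cvg_at_left_filter/cF.
- move=> x; rewrite in_itv/= => /andP[_ /dF] [_]; rewrite derive1E.
  by move=> ->.
Qed.

End LeftSingularFTC.

(** * The kernel integrals and their main term *)

Section KernelIntegrals.
Context {R : realType}.
Local Notation leb := (@lebesgue_measure R).

Lemma le0_ger_powR (r x y : R) : r <= 0 -> 0 < x -> x <= y -> y `^ r <= x `^ r.
Proof.
move=> r0 x0 xy; have y0 := lt_le_trans x0 xy.
rewrite -[r]opprK !(powRN _ (- r)) lef_pV2 ?posrE ?powR_gt0//.
by apply: ge0_ler_powR; rewrite ?nnegrE ?oppr_ge0 ?(ltW x0) ?(ltW y0).
Qed.

Lemma measurable_powR_affine (c e p : R) : measurable_fun setT (fun x : R => (e * x + c) `^ p).
Proof.
apply: (measurableT_comp (measurable_powR p)).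
by apply: measurable_funD => //; apply: measurable_funM.
Qed.

Lemma measurable_powR_revshift (c p : R) :
  measurable_fun setT (fun x : R => (c - x) `^ p).
Proof.
rewrite (_ : (fun x => _) = (fun x => (-1 * x + c) `^ p)); last first.
  by apply/funext => x; rewrite mulN1r addrC.
exact: measurable_powR_affine.
Qed.

Lemma ge0_integralZ_fin (D : set R) (f : R -> R) (k r : R) : measurable D -> 0 <= k ->
  measurable_fun D f -> (forall x, D x -> 0 <= f x) ->
  (\int[leb]_(x in D) (f x)%:E = r%:E)%E ->
  (\int[leb]_(x in D) (k * f x)%:E = (k * r)%:E)%E.
Proof.
move=> mD k0 mf f0 fr; under eq_integral do rewrite EFinM.
by rewrite ge0_integralZl_EFin// ?fr ?EFinM//; exact/measurable_EFinP.
Qed.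

(* The integer [N] below is [n - 1] in the notation of [j_nH]. *)
Definition inner_int (al : R) (N : nat) (x : R) : R :=
  \int[leb]_(v in `[0%R, 1%R]) ((v + N%:R) `^ al * (v + N%:R - x) `^ (al - 1)).

Definition outer_int (al : R) (N i : nat) : R :=
  \int[leb]_(x in `[i%:R - 1, i%:R]) (x `^ (- al) * inner_int al N x).

Variable al : R.
Hypothesis al0 : 0 < al.
Hypothesis al1 : al < 1.

(** The integral of (v+N-x)^(al-1) over v in [0,1], for x <= N. At x = N the integrand is singular
    at v = 0. *)
Definition unit_slice (N : nat) (x : R) : R :=
  ((N.+1%:R - x) `^ al - (N%:R - x) `^ al) / al.

Lemma unit_slice_ge0 N x : x <= N%:R -> 0 <= unit_slice N x.
Proof.
move=> xN; apply: divr_ge0; last exact: ltW.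
rewrite subr_ge0.
by apply: ge0_ler_powR; rewrite ?nnegrE ?(ltW al0) -?natr1//; lra.
Qed.

(** On [0,1] the factor (v+N)^al stays between N^al and (N+1)^al; the other factor integrates
    exactly. *)
Lemma inner_int_slice N x : x <= N%:R ->
  N%:R `^ al * unit_slice N x <= inner_int al N x <= N.+1%:R `^ al * unit_slice N x.
Proof.
move=> xN.
have S k : 0 <= k -> (\int[leb]_(v in `[0%R, 1%R]) (k * (v + N%:R - x) `^ (al - 1))%:E =
    (k * unit_slice N x)%:E)%E.
  move=> k0; apply: ge0_integralZ_fin => //.
  - apply: measurable_funTS; have := measurable_powR_affine (N%:R - x) 1 (al - 1).
    by under eq_fun do rewrite mul1r addrA.
  - by move=> v _; exact: powR_ge0.
  under eq_integral do rewrite -addrA.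
  rewrite integral_powR_shift ?add0r ?subr_ge0//.
  by rewrite /unit_slice -natr1 addrA (addrC 1).
have NS v : `[0, 1]%classic v ->
    0 <= (v + N%:R : R) /\ N%:R `^ al <= (v + N%:R) `^ al <= N.+1%:R `^ al.
  rewrite /= in_itv/= => /andP[v0 v1]; have N0 : 0 <= N%:R :> R by [].
  split; first by lra.
  by apply/andP; split; apply: ge0_ler_powR; rewrite ?nnegrE ?(ltW al0) -?natr1//; lra.
have U : (\int[leb]_(v in `[0%R, 1%R]) (N.+1%:R `^ al * (v + N%:R - x) `^ (al - 1))%:E < +oo)%E.
  by rewrite S ?powR_ge0// ltry.
have [|I1 le1] := ge0_le_Rintegral leb `[0, 1]
  (fun v => (v + N%:R) `^ al * (v + N%:R - x) `^ (al - 1)) _ _ U.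
  move=> v /NS[_ /andP[_ h]]; rewrite mulr_ge0 ?powR_ge0//=.
  by rewrite ler_wpM2r ?powR_ge0.
have [|I2 le2] := ge0_le_Rintegral leb `[0, 1]
  (fun v => N%:R `^ al * (v + N%:R - x) `^ (al - 1)) _ _ I1.
  move=> v /NS[_ /andP[h _]]; rewrite mulr_ge0 ?powR_ge0//=.
  by rewrite ler_wpM2r ?powR_ge0.
apply/andP; split.
  by apply: le_trans le2; rewrite /Rintegral S ?powR_ge0.
by apply: le_trans le1 _; rewrite /Rintegral S ?powR_ge0.
Qed.

Lemma inner_int_ge0 N x : 0 <= inner_int al N x.
Proof. by apply: Rintegral_ge0 => v _; rewrite mulr_ge0// powR_ge0. Qed.

(** The second difference of t^(al+1)/(al(al+1)) at k+1, that is 2 rho_h(k+1)/(al(al+1)) with 2h =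
    al+1. *)
Definition slice_sum (k : nat) : R :=
  (k.+2%:R `^ (al + 1) + k%:R `^ (al + 1) - 2 * k.+1%:R `^ (al + 1)) / (al * (al + 1)).

Lemma integral_unit_slice (N k : nat) : (k < N)%N ->
  (\int[leb]_(x in `[((N - k)%N%:R - 1)%R, (N - k)%N%:R%R]) (unit_slice N x)%:E =
  (slice_sum k)%:E)%E.
Proof.
move=> kN; have Nk : (N - k)%N%:R = N%:R - k%:R :> R by rewrite natrB// ltnW.
set a := _ - 1; set b := _%:R; set D := `[a, b]%classic.
have ab : a < b by rewrite /a; lra.
have bN : b <= N%:R by rewrite /b Nk gerBl.
have bN1 : b <= N.+1%:R by rewrite -natr1; lra.
have m (c : R) : measurable_fun D (fun x : R => (c - x) `^ al).
  apply: measurable_funTS.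
  exact: measurable_powR_revshift.
have itg (c : R) : b <= c -> leb.-integrable D (EFin \o (fun x : R => (c - x) `^ al)).
  move=> bc; apply/integrableP; split; first by apply/measurable_EFinP; exact: m.
  under eq_integral do rewrite /= ger0_norm ?powR_ge0//.
  by rewrite (integral_powR_revshift a b c al)// ltry.
transitivity (\int[leb]_(x in D) (al^-1 * ((N.+1%:R - x) `^ al - (N%:R - x) `^ al))%:E)%E.
  by apply: eq_integral => x _; rewrite mulrC.
pose V := ((N.+1%:R - a) `^ (al + 1) - (N.+1%:R - b) `^ (al + 1)) / (al + 1) -
  ((N%:R - a) `^ (al + 1) - (N%:R - b) `^ (al + 1)) / (al + 1).
transitivity (al^-1 * V)%:E; last first.
  rewrite /V /slice_sum; congr (_%:E).
  have -> : N.+1%:R - a = k.+2%:R by rewrite /a Nk -!natr1; ring.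
  have -> : N.+1%:R - b = k.+1%:R by rewrite /b Nk -!natr1; ring.
  have -> : N%:R - a = k.+1%:R by rewrite /a Nk -!natr1; ring.
  have -> : N%:R - b = k%:R by rewrite /b Nk; ring.
  have a0 : al != 0 by rewrite gt_eqF.
  have a1 : al + 1 != 0 by rewrite gt_eqF// addr_gt0.
  by field; rewrite a0 a1.
have mD : measurable D by exact: measurable_itv.
have i0 : 0 <= al^-1 by rewrite invr_ge0 ltW.
apply: ge0_integralZ_fin => //.
- by apply: measurable_funB; exact: m.
- move=> x; rewrite /D/= in_itv/= => /andP[_ xb]; rewrite subr_ge0.
  by apply: ge0_ler_powR; rewrite ?nnegrE ?subr_ge0 ?(ltW al0) -?natr1//; lra.
rewrite integralB_EFin//; [|exact: itg..].
by rewrite (integral_powR_revshift a b N.+1%:R al)// (integral_powR_revshift a b N%:R al)// -EFinB.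
Qed.

End KernelIntegrals.

(** * Limits and bounds for the kernel integrals *)

Section KernelAsymptotics.
Context {R : realType}.
Local Notation leb := (@lebesgue_measure R).
Variable al : R.
Hypothesis al0 : 0 < al.
Hypothesis al1 : al < 1.

Lemma measurable_unit_slice N : measurable_fun setT (unit_slice al N).
Proof.
apply: measurable_funM => //.
by apply: measurable_funB; exact: measurable_powR_revshift.
Qed.

Lemma outer_int_ge0 N i : 0 <= outer_int al N i.
Proof. by apply: Rintegral_ge0 => x _; rewrite mulr_ge0 ?powR_ge0// inner_int_ge0. Qed.

(** With N = M+k+2, x runs over [M+1, M+2], away from 0. The lower bound uses x <= N, and the upper
    one (N+1)/(M+1) = 1 + (k+2)/(M+1). *)
Lemma outer_int_sandwich M k :
  slice_sum al k <= outer_int al (M + k.+2) (M + k.+2 - k) <=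
  (1 + k.+2%:R * harmonic M) `^ al * slice_sum al k.
Proof.
set N := (M + k.+2)%N.
have kN : (k < N)%N by rewrite /N -ltnS -addnS (leq_trans _ (leq_addl _ _)).
have iM : (N - k)%N = M.+2 by rewrite /N -2!addSnnS addnK.
have N0 : 0 < N%:R :> R by rewrite ltr0n (leq_trans _ kN).
set i := (N - k)%N in iM *.
set D := `[(i%:R - 1 : R), i%:R]%classic.
have mD : measurable D by exact: measurable_itv.
have Dx x : D x -> [/\ M.+1%:R <= x, x <= M.+2%:R & x <= N%:R].
  rewrite /D/= in_itv/= => /andP[h1 h2].
  have iN : i%:R <= N%:R :> R by rewrite ler_nat leq_subr.
  by split; [move: h1|move: h2|exact: le_trans iN]; rewrite iM// -(@natr1 _ M.+1) addrK.
have S (c : R) : 0 <= c ->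
    (\int[leb]_(x in D) (c * unit_slice al N x)%:E = (c * slice_sum al k)%:E)%E.
  move=> c0; apply: ge0_integralZ_fin => //.
  - by apply: measurable_funTS; exact: measurable_unit_slice.
  - by move=> x /Dx[_ _ xN]; exact: unit_slice_ge0.
  - by rewrite integral_unit_slice.
have U : (\int[leb]_(x in D) ((1 + k.+2%:R * harmonic M) `^ al * unit_slice al N x)%:E < +oo)%E.
  by rewrite S ?powR_ge0// ltry.
have [|I1 le1] := ge0_le_Rintegral leb D (fun x => x `^ (- al) * inner_int al N x) _ _ U.
  move=> x /Dx[h1 h2 xN]; have x0 : 0 < x by apply: lt_le_trans h1.
  rewrite mulr_ge0 ?powR_ge0 ?inner_int_ge0//=.
  have /andP[_ h] := inner_int_slice al al0 N x xN.
  apply: (@le_trans _ _ (x `^ (- al) * (N.+1%:R `^ al * unit_slice al N x))).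
    by rewrite ler_wpM2l ?powR_ge0.
  rewrite mulrA ler_wpM2r ?unit_slice_ge0//.
  apply: (@le_trans _ _ (M.+1%:R `^ (- al) * N.+1%:R `^ al)).
    by rewrite ler_wpM2r ?powR_ge0// le0_ger_powR// oppr_le0 ltW.
  have -> : 1 + k.+2%:R * harmonic M = M.+1%:R^-1 * N.+1%:R :> R.
    rewrite /N /harmonic/= -addSn natrD mulrDr mulVf ?pnatr_eq0// (mulrC k.+2%:R).
    by [].
  rewrite powRM ?invr_ge0//.
  by rewrite powRN -(powR_inv1 (ler0n R M.+1)) -powRrM mulN1r powRN.
have [|I2 le2] := ge0_le_Rintegral leb D (fun x => 1 * unit_slice al N x) _ _ I1.
  move=> x /Dx[h1 h2 xN]; have x0 : 0 < x by apply: lt_le_trans h1.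
  rewrite mul1r unit_slice_ge0//=.
  have /andP[h _] := inner_int_slice al al0 N x xN.
  apply: (@le_trans _ _ (x `^ (- al) * (N%:R `^ al * unit_slice al N x))); last first.
    by rewrite ler_wpM2l ?powR_ge0.
  rewrite mulrA -[leLHS]mul1r ler_wpM2r ?unit_slice_ge0//.
  rewrite powRN mulrC ler_pdivlMr ?powR_gt0// mul1r.
  by apply: ge0_ler_powR; rewrite ?nnegrE ?(ltW al0) ?(ltW x0) ?(ltW N0).
apply/andP; split.
  by apply: le_trans le2; rewrite /Rintegral S// mul1r.
by apply: le_trans le1 _; rewrite /Rintegral S ?powR_ge0.
Qed.

Lemma outer_int_cvg k : outer_int al N (N - k) @[N --> \oo] --> slice_sum al k.
Proof.
rewrite -(cvg_shiftn k.+2).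
apply: (@squeeze_cvgr _ _ _ _ (fun=> slice_sum al k)
  (fun M => (1 + k.+2%:R * harmonic M) `^ al * slice_sum al k)).
- by apply: nearW => M; exact: outer_int_sandwich.
- exact: cvg_cst.
have e1 : (1 : R) `^ al = 1 by rewrite powR1.
suff : (1 + k.+2%:R * harmonic M) `^ al * slice_sum al k @[M --> \oo] -->
    (1 : R) `^ al * slice_sum al k by rewrite e1 mul1r.
apply: cvgM; last exact: cvg_cst.
have h : {for (1 : R), continuous (@powR R ^~ al)}.
  apply/differentiable_continuous/derivable1_diffP/derivable_powR.
  by rewrite in_itv/= andbT.
apply: (continuous_cvg _ h).
rewrite -[X in _ --> X]addr0; apply: cvgD; first exact: cvg_cst.
rewrite -[X in _ --> X](mulr0 k.+2%:R); apply: cvgM; first exact: cvg_cst.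
exact: cvg_harmonic.
Qed.

(** As x <= N-k, the distance v+N-x is at least k > 0, which bounds the singular factor. The weight
    x^(-al) is integrated exactly, so the last cell [0,1] is included. *)
Lemma outer_int_le N k : (0 < k < N)%N ->
  outer_int al N (N - k) <=
  N.+1%:R `^ al * k%:R `^ (al - 1) * (N - k)%N%:R `^ (- al) / (1 - al).
Proof.
move=> /andP[k0 kN]; set i := (N - k)%N.
have i0 : (0 < i)%N by rewrite subn_gt0.
have i1 : 1 <= i%:R :> R by rewrite ler1n.
have iN : i%:R = N%:R - k%:R :> R by rewrite natrB// ltnW.
set D := `[(i%:R - 1 : R), i%:R]%classic.
have mD : measurable D by exact: measurable_itv.
have m1 : measurable_fun setT (fun x : R => x `^ (- al)) by exact: measurable_powR.
have S (c : R) : 0 <= c -> (\int[leb]_(x in D) (c * x `^ (- al))%:E =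
    (c * ((i%:R `^ (1 - al) - (i%:R - 1) `^ (1 - al)) / (1 - al)))%:E)%E.
  move=> c0; apply: ge0_integralZ_fin => //.
  - exact: measurable_funTS.
  - by move=> x _; exact: powR_ge0.
  have h1 : 0 <= i%:R - 1 + 0 :> R by rewrite addr0 subr_ge0.
  have h2 : i%:R - 1 < i%:R :> R by rewrite ltrBlDr ltrDl.
  have h3 : 0 < 1 - al by rewrite subr_gt0.
  have := integral_powR_shift _ _ 0 _ h1 h2 h3; rewrite !addr0 => <-.
  by apply: eq_integral => x _; rewrite addr0 addrAC subrr add0r.
set C := N.+1%:R `^ al * k%:R `^ (al - 1).
have C0 : 0 <= C by rewrite mulr_ge0 ?powR_ge0.
have U : (\int[leb]_(x in D) (C * x `^ (- al))%:E < +oo)%E by rewrite S// ltry.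
have [|_ le1] := ge0_le_Rintegral leb D (fun x => x `^ (- al) * inner_int al N x) _ _ U.
  move=> x; rewrite /D/= in_itv/= => /andP[xi1 xi].
  rewrite mulr_ge0 ?powR_ge0 ?inner_int_ge0//= mulrC ler_wpM2r ?powR_ge0//.
  have V : (\int[leb]_(v in `[0%R, 1%R]) C%:E < +oo)%E.
    by rewrite integral_cst//= lebesgue_measure_itv/= lte01 -EFinD -EFinM ltry.
  have [|_ le2] := ge0_le_Rintegral leb `[0, 1]
    (fun v => (v + N%:R) `^ al * (v + N%:R - x) `^ (al - 1)) _ _ V.
    move=> v /=; rewrite in_itv/= => /andP[v0 v1].
    rewrite mulr_ge0 ?powR_ge0//= ler_pM ?powR_ge0//.
      apply: ge0_ler_powR; rewrite ?nnegrE ?(ltW al0)// -?natr1 ?addr_ge0//; lra.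
    by apply: le0_ger_powR; rewrite ?ltr0n// ?subr_le0 ?(ltW al1)//; lra.
  apply: le_trans le2 _.
  by rewrite /Rintegral integral_cst//= lebesgue_measure_itv/= lte01 -EFinD -EFinM/= subr0 mulr1.
apply: le_trans le1 _; rewrite /Rintegral S//= -mulrA ler_wpM2l//.
rewrite ler_wpM2r ?invr_ge0 ?subr_ge0 ?(ltW al1)//.
have p (x : R) : 0 <= x -> x `^ (1 - al) = x * x `^ (- al).
  by move=> x0; rewrite -(mulr_powRB1 x0) ?subr_gt0// addrAC subrr add0r.
rewrite (p i%:R)// (p (i%:R - 1)) ?subr_ge0//.
(* The comparison of (i-1)^(-al) with i^(-al) needs i > 1; at i = 1 the term carries the factor
   0. *)
have [i10|i10] := eqVneq (i%:R - 1 : R) 0.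
  have i1E : i%:R = 1 :> R by apply/eqP; rewrite -subr_eq0 i10.
  by rewrite i10 mul0r subr0 i1E mul1r.
have i1' : 0 < i%:R - 1 :> R by rewrite lt_neqAle eq_sym i10 subr_ge0.
have : i%:R `^ (- al) <= (i%:R - 1) `^ (- al) :> R by apply: le0_ger_powR; rewrite ?oppr_le0 ?(ltW al0)//; lra.
by move=> h; have := ler_wpM2l (ltW i1') h; lra.
Qed.

End KernelAsymptotics.

(** * Sums of powers of integers *)

Section PowerSums.
Context {R : realType}.
Implicit Types s : R.

(** Mean value theorem for x^(1-s): its derivative decreases, hence is smallest at the right
    endpoint. Continuity at 0 covers i = 0. *)
Lemma natpow_increment s (i : nat) : 0 < s < 1 ->
  (1 - s) * i.+1%:R `^ (- s) <= i.+1%:R `^ (1 - s) - i%:R `^ (1 - s).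
Proof.
move=> /andP[s0 s1]; have s1' : 0 < 1 - s by rewrite subr_gt0.
pose F (x : R) := `|x| `^ (1 - s).
have [|||c] := @MVT R F (fun x => (1 - s) * `|x| `^ (1 - s - 1)) i%:R i.+1%:R.
- by rewrite ltr_nat.
- move=> x; rewrite in_itv/= => /andP[ix _].
  by apply: is_derive_norm_powR; exact: le_lt_trans ix.
- by apply: continuous_subspaceT; exact: norm_powR_continuous.
rewrite in_itv/= => /andP[ic ci]; have c0 : 0 < c by exact: le_lt_trans ic.
rewrite /F (ger0_norm (ler0n _ _)) (ger0_norm (ler0n _ _)) (gtr0_norm c0) => ->.
have -> : i.+1%:R - i%:R = 1 :> R by rewrite -natr1 addrAC subrr add0r.
rewrite mulr1 ler_wpM2l ?(ltW s1')//.
by rewrite addrAC subrr add0r le0_ger_powR// ?oppr_le0 ltW.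
Qed.

Lemma natpow_decrement s (k : nat) : 0 < s < 1 ->
  (1 - s) * k.+2%:R `^ (s - 2) <= k.+1%:R `^ (s - 1) - k.+2%:R `^ (s - 1).
Proof.
move=> /andP[s0 s1]; have s1' : 0 < 1 - s by rewrite subr_gt0.
pose F (x : R) := `|x| `^ (s - 1).
have dF (x : R) : k.+1%:R <= x -> is_derive x 1 F ((s - 1) * `|x| `^ (s - 1 - 1)).
  by move=> kx; apply: is_derive_norm_powR; exact: lt_le_trans kx.
have [|||c] := @MVT R F (fun x => (s - 1) * `|x| `^ (s - 1 - 1)) k.+1%:R k.+2%:R.
- by rewrite ltr_nat.
- by move=> x; rewrite in_itv/= => /andP[/ltW /dF].
- apply: derivable_within_continuous => x; rewrite in_itv/= => /andP[kx _].
  by have [] := dF _ kx.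
rewrite in_itv/= => /andP[kc ck]; have c0 : 0 < c by exact: lt_trans kc.
rewrite /F (ger0_norm (ler0n _ _)) (ger0_norm (ler0n _ _)) (gtr0_norm c0).
have -> : k.+2%:R - k.+1%:R = 1 :> R by rewrite -natr1 addrAC subrr add0r.
rewrite mulr1 => E.
have h : k.+2%:R `^ (s - 2) <= c `^ (s - 2) by rewrite le0_ger_powR// ?ltW//; lra.
have e2 : s - 1 - 1 = s - 2 by ring.
rewrite e2 in E.
by have := ler_wpM2l (ltW s1') h; lra.
Qed.

Lemma sum_natpow_le s N : 0 < s < 1 ->
  (1 - s) * \sum_(i < N) i.+1%:R `^ (- s) <= N%:R `^ (1 - s).
Proof.
move=> s01; elim: N => [|N IH]; first by rewrite big_ord0 mulr0 powR_ge0.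
rewrite big_ord_recr/= mulrDr.
by have := natpow_increment s N s01; lra.
Qed.

Lemma sum_natpow_tail_le s M N : 0 < s < 1 ->
  (1 - s) * \sum_(M.+2 <= k < N) k%:R `^ (s - 2) <= M.+1%:R `^ (s - 1).
Proof.
move=> s01; have [NM|MN] := leqP N M.+2; first by rewrite big_geq// mulr0 powR_ge0.
(* The bound is strengthened to its telescoping form so that the induction closes. *)
suff : (1 - s) * \sum_(M.+2 <= k < N) k%:R `^ (s - 2) <=
    M.+1%:R `^ (s - 1) - N.-1%:R `^ (s - 1).
  by have := powR_ge0 (N.-1%:R : R) (s - 1); lra.
rewrite -(subnKC (ltnW MN)); elim: (N - M.+2)%N => [|n IH].
  by rewrite addn0 big_geq// mulr0 subrr.
rewrite addnS big_nat_recr/= ?leq_addr// mulrDr.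
have := natpow_decrement s (M + n) s01; move: IH.
rewrite !addSn /=; lra.
Qed.

End PowerSums.

(** * Uniformly small tails of the sums of squares *)

Section KernelTail.
Context {R : realType}.
Variable al : R.
Hypothesis al0 : 0 < al.
Hypothesis al12 : al < 1 / 2.

Let s := 2 * al.

Lemma sqr_powR (x : R) : (x `^ al) ^+ 2 = x `^ s.
Proof. by rewrite -(powR_mulrn _ (powR_ge0 _ _)) -powRrM mulrC. Qed.

(** If 2k <= N then N-k >= N/2, and N^s cancels against (N-k)^(-s); otherwise k > N/2, and k^(s-2)
    is comparable to N^(s-2). The constants come from (N+1)^s <= 2 N^s, 2^s <= 2 and 2^(2-s) <=
    4. *)
Lemma kernel_weight_le (N k : nat) : (0 < k < N)%N ->
  N.+1%:R `^ s * k%:R `^ (s - 2) * (N - k)%N%:R `^ (- s) <=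
  4 * k%:R `^ (s - 2) + 8 * (N%:R `^ (s + (s - 2)) * (N - k)%N%:R `^ (- s)) :> R.
Proof.
have s0 : 0 < s by rewrite /s mulr_gt0.
have s1 : s < 1 by rewrite /s; have := al12; lra.
move=> /andP[k0 kN].
have i0 : (0 < N - k)%N by rewrite subn_gt0.
have n0 : 0 < N%:R :> R by rewrite ltr0n (ltn_trans k0).
have pos (x : R) : 0 < x -> 0 < x `^ s by exact: powR_gt0.
have h2s : (2 : R) `^ s <= 2 by apply: ler1_powR; [rewrite ler1n|exact: ltW].
have n1 : N.+1%:R `^ s <= 2 * N%:R `^ s :> R.
  apply: (@le_trans _ _ ((2 * N%:R) `^ s)).
    apply: ge0_ler_powR; rewrite ?nnegrE ?(ltW s0) ?mulr_ge0//.
    by rewrite -natrM ler_nat mul2n -addnn -addn1 leq_add2l (leq_trans k0 (ltnW kN)).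
  by rewrite powRM// ler_wpM2r ?powR_ge0.
set i := (N - k)%N in i0 *.
have iE : i%:R = N%:R - k%:R :> R by rewrite natrB// ltnW.
have i0' : 0 < i%:R :> R by rewrite ltr0n.
have k0' : 0 < k%:R :> R by rewrite ltr0n.
have [kn|nk] := leP (2 * k%:R) (N%:R : R).
  apply: (@le_trans _ _ (4 * k%:R `^ (s - 2))); last first.
    by rewrite lerDl mulr_ge0// mulr_ge0 ?powR_ge0.
  rewrite mulrAC ler_wpM2r ?powR_ge0//.
  rewrite powRN ler_pdivrMr ?powR_gt0//.
  have ni : N%:R `^ s <= 2 * i%:R `^ s :> R.
    apply: (@le_trans _ _ ((2 * i%:R) `^ s)).
      by apply: ge0_ler_powR; rewrite ?nnegrE ?(ltW s0) ?mulr_ge0//; lra.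
    by rewrite powRM// ler_wpM2r ?powR_ge0.
  by lra.
apply: (@le_trans _ _ (8 * (N%:R `^ (s + (s - 2)) * i%:R `^ (- s)))); last first.
  by rewrite lerDr mulr_ge0// powR_ge0.
rewrite mulrA ler_wpM2r ?powR_ge0//.
rewrite [in leRHS]powRD; last by rewrite (gt_eqF n0) implybT.
have kp : k%:R `^ (s - 2) <= 4 * N%:R `^ (s - 2) :> R.
  apply: (@le_trans _ _ ((2^-1 * N%:R) `^ (s - 2))).
    by apply: le0_ger_powR; rewrite ?mulr_gt0//; lra.
  rewrite powRM// ler_wpM2r ?powR_ge0//.
  rewrite -(powR_inv1 (ler0n R 2)) -powRrM mulN1r opprB.
  apply: (@le_trans _ _ (2 `^ 2%:R)); last by rewrite powR_mulrn//; lra.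
  by apply: ler_powR; lra.
rewrite (_ : 8 = 2 * 4); last by ring.
rewrite mulrACA ler_pM ?powR_ge0//.
Qed.

Lemma outer_int_sqr_le (N k : nat) : (0 < k < N)%N ->
  outer_int al N (N - k) ^+ 2 <=
  (1 - al) ^- 2 * (4 * k%:R `^ (s - 2) +
    8 * (N%:R `^ (s + (s - 2)) * (N - k)%N%:R `^ (- s))).
Proof.
move=> kN; have al1 : al < 1 by have := al12; lra.
have h := outer_int_le al al0 al1 N k kN.
apply: (@le_trans _ _ ((N.+1%:R `^ al * k%:R `^ (al - 1) *
   (N - k)%N%:R `^ (- al) / (1 - al)) ^+ 2)).
  by rewrite ler_sqr ?nnegrE// ?outer_int_ge0// (le_trans _ h)// outer_int_ge0.
rewrite !exprMn mulrC -exprVn ler_wpM2l ?sqr_ge0//.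
apply: le_trans (kernel_weight_le N k kN).
rewrite le_eqVlt; apply/orP; left; apply/eqP; congr (_ * _ * _).
- exact: sqr_powR.
- by rewrite -(powR_mulrn _ (powR_ge0 _ _)) -powRrM /s; congr (_ `^ _); ring.
- by rewrite -(powR_mulrn _ (powR_ge0 _ _)) -powRrM /s; congr (_ `^ _); ring.
Qed.

(** The two parts of the weight give 4 (M+1)^(s-1)/(1-s) and 8 N^(2s-2) N^(1-s)/(1-s); as N > M+1
    and s < 1, the latter is at most 8 (M+1)^(s-1)/(1-s), and 4 + 8 = 12. *)
Lemma outer_int_tail_le (M N : nat) :
  \sum_(M.+2 <= k < N) outer_int al N (N - k) ^+ 2 <=
  (1 - al) ^- 2 * 12 / (1 - s) * M.+1%:R `^ (s - 1).
Proof.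
have s0 : 0 < s by rewrite /s mulr_gt0.
have s1 : s < 1 by rewrite /s; have := al12; lra.
have s01 : 0 < s < 1 by rewrite s0 s1.
have s1' : 0 < 1 - s by rewrite subr_gt0.
have D0 : 0 <= (1 - al) ^- 2 by rewrite -exprVn sqr_ge0.
have [NM|MN] := leqP N M.+2.
  by rewrite big_geq// mulr_ge0 ?powR_ge0// divr_ge0 ?mulr_ge0// ltW.
have N0 : 0 < N%:R :> R by rewrite ltr0n (leq_trans _ MN).
apply: (@le_trans _ _ (\sum_(M.+2 <= k < N) ((1 - al) ^- 2 * (4 * k%:R `^ (s - 2) +
    8 * (N%:R `^ (s + (s - 2)) * (N - k)%N%:R `^ (- s)))))).
  apply: ler_sum_nat => k /andP[Mk kN]; apply: outer_int_sqr_le.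
  by rewrite kN andbT (leq_trans _ Mk).
rewrite -mulr_sumr -!mulrA ler_wpM2l// big_split/= -!mulr_sumr.
set A := \sum_(_ <= k < _) k%:R `^ _; set B := \sum_(_ <= k < _) _.
set n2 := N%:R `^ (s + _).
have hA : (1 - s) * A <= M.+1%:R `^ (s - 1) by exact: sum_natpow_tail_le.
have hB : (1 - s) * B <= N%:R `^ (1 - s).
  apply: le_trans (sum_natpow_le s N s01); rewrite ler_wpM2l ?(ltW s1')//.
  rewrite -(big_mkord xpredT (fun i => i.+1%:R `^ (- s))) big_nat_rev/= add0n.
  rewrite [leRHS](big_cat_nat (n := M.+2))//=; last exact: ltnW.
  apply: ler_wpDl; first by apply: sumr_ge0 => i _; exact: powR_ge0.
  rewrite le_eqVlt; apply/orP; left; apply/eqP; apply: eq_big_nat => k /andP[_ kN].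
  by rewrite subnSK.
have n2N : n2 * N%:R `^ (1 - s) = N%:R `^ (s - 1).
  rewrite /n2 -powRD; last by rewrite (gt_eqF N0) implybT.
  by congr (_ `^ _); ring.
have n20 : 0 <= n2 by exact: powR_ge0.
have NM : N%:R `^ (s - 1) <= M.+1%:R `^ (s - 1) :> R.
  by apply: le0_ger_powR; rewrite ?subr_le0 ?(ltW s1)// ler_nat ltnW// ltnW.
have := ler_wpM2l n20 hB; rewrite n2N => hB'.
rewrite [leRHS](_ : _ = (12 * M.+1%:R `^ (s - 1)) / (1 - s)); last by ring.
rewrite ler_pdivlMr//; lra.
Qed.

Lemma outer_int_tail_small (e : R) : 0 < e ->
  exists K, forall N, \sum_(K <= k < N) outer_int al N (N - k) ^+ 2 <= e.
Proof.
move=> e0.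
have s1 : s < 1 by rewrite /s; have := al12; lra.
have s1' : 0 < 1 - s by rewrite subr_gt0.
have al1 : 0 < 1 - al by have := al12; lra.
pose C := (1 - al) ^- 2 * 12 / (1 - s).
have C0 : 0 < C by rewrite divr_gt0// mulr_gt0// -exprVn exprn_gt0// invr_gt0.
have eC : 0 < e / C by rewrite divr_gt0.
(* The solution of C t^(s-1) = e; since s < 1, any M with M+1 > t suffices. *)
pose t := (e / C) `^ (s - 1)^-1.
have t0 : 0 < t by exact: powR_gt0.
exists (Num.truncn t).+2 => N; apply: le_trans (outer_int_tail_le _ _) _.
rewrite -/C mulrC -ler_pdivlMr//.
have -> : e / C = t `^ (s - 1).
  rewrite /t -powRrM mulVf ?powRr1 ?(ltW eC)// subr_eq0 lt_eqF//.
by apply: le0_ger_powR; rewrite ?subr_le0 ?(ltW s1) ?(ltW (truncnS_gt _)).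
Qed.

End KernelTail.

(** * Identification of the coefficients and conclusion *)

Lemma j_nH_outer_int (R : realType) (sigma H : R) (n i : nat) :
  j_nH sigma H n.+1 i = sigma * C_H H * outer_int (H - 1 / 2) n i.
Proof.
rewrite /j_nH /outer_int (opprB H).
under eq_Rintegral => x _.
  under eq_Rintegral => v _.
    rewrite -natr1 addrA addrK (_ : H - 3 / 2 = H - 1 / 2 - 1); last by field.
    over.
  over.
by [].
Qed.

Theorem theorem5p4 (R : realType) (d : measure_display) (T : measurableType d)
    (P : probability T R) (xi : nat -> T -> R) (H sigma : R) :
  1 / 2 < H -> H < 1 -> 0 < sigma ->
  (forall k, measurable_fun setT (xi k)) ->
  mutually_independent P xi [set k | (1 <= k)%N] ->
  (forall k, (1 <= k)%N -> rademacher P (xi k)) ->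
  cvg_in_distribution P (Yn sigma H xi) (YH sigma H xi).
Proof.
move=> H12 H1 _ mxi ixi rxi.
have al0 : 0 < H - 1 / 2 by rewrite subr_gt0.
have al12 : H - 1 / 2 < 1 / 2 by lra.
have al1 : H - 1 / 2 < 1 by lra.
apply: cvg_in_distribution_coef => //.
  move=> k; under eq_fun do rewrite j_nH_outer_int.
  (* The factor H-1/2 of [C_H] cancels one denominator of [slice_sum], and the other, al+1 = H+1/2,
     is that of [g_H]. *)
  have -> : 2 * g_H sigma H * rho (h_of H) k.+1 =
      sigma * C_H H * slice_sum (H - 1 / 2) k.
    rewrite /g_H /rho /h_of /C_H /slice_sum/=.
    have -> : 2 * (H / 2 + 1 / 4) = H - 1 / 2 + 1 by field.
    by field; rewrite !gt_eqF//; lra.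
  by apply: cvgM; [exact: cvg_cst|exact: outer_int_cvg].
move=> e e0; set C := sigma * C_H H.
(* Dividing by [C ^+ 2 + 1] keeps the quotient meaningful whatever the value of [C]. *)
have C1 : 0 < C ^+ 2 + 1 by rewrite ltr_wpDl ?sqr_ge0.
have [K KP] := outer_int_tail_small _ al0 al12 _ (divr_gt0 e0 C1).
exists K => n.
under eq_bigr do rewrite j_nH_outer_int -/C exprMn.
rewrite -mulr_sumr.
apply: le_trans (ler_wpM2l (sqr_ge0 C) (KP n)) _.
by rewrite mulrCA ger_pMr// ler_pdivrMr// mul1r lerDl.
Qed.
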